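(* Let $G$ be a generator matrix on the discrete space $\mathcal X$ without zero rows (i.e. $G_{i,i}\neq0$ for all $i$). Let $\theta>0$ and $M\in\mathbb N$ be such that $M,\theta>\inf\{r>0: I+r^{-1}G\text{ is entrywise non-negative}\}$, and set $Q=I+G/\theta$. Let $\pi$ be a probability vector on $\mathcal X$ and $\mu$ a stationary distribution of $Q$ such that $\pi^tQ^n\to\mu^t$ entrywise as $n\to\infty$. Let $K_n=I+\frac Gn\mathbb 1(n>M)$ and let $\mathbf T$ be the time-inhomogeneous Markov chain with initial distribution $\pi$ and $\mathbb P(T_{n+1}=j\mid T_n=i)=K_n(i,j)$. Define $(\mathbf P_n,\mathbf Y_n)$ from $\mathbf T$ as in the context, and define $G'_{i,j}=\frac{\mu_j}{\mu_i}G_{j,i}\mathbb 1(\mu_i\ne0)$. Then $G'$ is a generator matrix, $\mathbf Y_n$ converges weakly (in finite-dimensional distributions) to the homogeneous Markov chain $\mathbf Y'$ with kernel $K_{G'}$ and initial distribution $\mu$; for a possible sequence $\mathbf y$ of $\mathbf Y'$, $\mathbf P_n\mid\mathbf Y_n=\mathbf y$ converges weakly to a disordered GEM $\mathbf P'$ with parameters $\{-G'_{y_j,y_j}\}_{j\ge1}$; and the pairs $(\mathbf P_n,\mathbf Y_n)$ converge weakly (in finite-dimensional distributions on $[0,1]^{\mathbb N}\times\mathcal X^{\mathbb N}$) to a pair $(\mathbf P',\mathbf Y')$ with MCcGEM$(G')$ distribution with respect to $\mu$.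
   Context: Conventions: empty sums $0$, empty products $1$, $1/0=\infty$, $0/0=0$, $0^0=1$; Beta$(1,0)\equiv1$. A generator matrix on $\mathcal X$: $G_{i,j}\ge0$ ($i\ne j$), $G_{i,i}=-\sum_{j\ne i}G_{i,j}$, $\sup_i|G_{i,i}|<\infty$. $K_G(w,z)=G_{w,z}/(-G_{w,w})$ if $w\ne z$, $G_{w,w}\ne0$; $=1$ if $w=z$, $G_{w,w}=0$; $=0$ otherwise. Disordered GEM with parameters $\{\theta_j\}$: $P_j=X_j\prod_{i<j}(1-X_i)$ with independent $X_j\sim$ Beta$(1,\theta_j)$. MCcGEM$(G)$ with respect to $\mu$: law of $(\mathbf P,\mathbf Y)$ with $\mathbf Y$ a Markov chain with kernel $K_G$, initial law $\mu$, and given $\mathbf Y=\mathbf y$, $\mathbf P$ a disordered GEM with parameters $\{-G_{y_j,y_j}\}$. Reverse clumping: let $V_1=1$, $V_{j+1}=\inf\{v>V_j:T_v\ne T_{v-1}\}$, $N_n=\min\{i:V_i>n\}$. Set $\tau_{n,1}=n+1-V_{N_n-1}$, $\tau_{n,k}=V_{N_n-(k-1)}-V_{N_n-k}$ for $1<k<N_n$, $\tau_{n,i}=0$ for $i\ge N_n$; $Y_{n,1}=T_n$, $Y_{n,k}=T_{V_{N_n-k}}$ for $1<k<N_n$, $Y_{n,i}=T_1$ for $i\ge N_n$; $P_{n,j}=\tau_{n,j}/n$; $\mathbf P_n=\langle P_{n,j}\rangle_{j\ge1}$, $\mathbf Y_n=\{Y_{n,j}\}_{j\ge1}$. A possible sequence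 $\mathbf y$ of $\mathbf Y'$: all finite initial segments have positive probability. *)

(* Defs.v *)
From HB Require Import structures.
From mathcomp Require Import all_boot all_order all_algebra.
From mathcomp Require Import all_classical all_reals all_analysis.
Set Implicit Arguments. Unset Strict Implicit. Unset Printing Implicit Defensive.
Import Order.TTheory GRing.Theory Num.Theory.
Import numFieldNormedType.Exports.
Local Open Scope classical_set_scope.
Local Open Scope ring_scope.

Definition dsum (R : realType) (T : choiceType) (D : set T) (a : T -> R) : R :=
  fine (\esum_(x in D) (Num.max (a x) 0)%:E)
  - fine (\esum_(x in D) (Num.max (- a x) 0)%:E).

Definition generator (R : realType) (X : countType) (G : X -> X -> R) : Prop :=
  [/\ (forall i j, i != j -> 0 <= G i j),
      (forall i, ((- G i i)%:E = \esum_(j in [set j | j != i]) (G i j)%:E)%E) &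
      (exists B : R, forall i, `|G i i| <= B)].

Definition prob_vec (R : realType) (X : countType) (p : X -> R) : Prop :=
  (forall i, 0 <= p i) /\ (\esum_(i in [set: X]) (p i)%:E = 1)%E.

Definition vecmul (R : realType) (X : countType) (v : X -> R) (A : X -> X -> R)
  : X -> R :=
  fun j => dsum [set: X] (fun i => v i * A i j).

Definition vecpow (R : realType) (X : countType) (v : X -> R) (A : X -> X -> R)
  (n : nat) : X -> R := iter n (fun w => vecmul w A) v.

Definition idm (R : realType) (X : countType) (i j : X) : R := (i == j)%:R.

Definition rate_bound (R : realType) (X : countType) (G : X -> X -> R) : R :=
  inf [set r : R | 0 < r /\ forall i j, 0 <= @idm R X i j + G i j / r].

Definition KG (R : realType) (X : countType) (G : X -> X -> R) (w z : X) : R :=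
  if (w != z) && (G w w != 0) then G w z / (- G w w)
  else if (w == z) && (G w w == 0) then 1 else 0.

Definition Grev (R : realType) (X : countType) (G : X -> X -> R) (mu : X -> R)
  (i j : X) : R :=
  mu j / mu i * G j i * (mu i != 0)%:R.

Definition Kn (R : realType) (X : countType) (G : X -> X -> R) (M n : nat)
  (i j : X) : R :=
  @idm R X i j + G i j / n%:R * (M < n)%:R.

(* Paths.  A path (T_1, ..., T_n) with n >= 1 is represented by the pair     *)
(* (T_1, [:: T_2; ...; T_n]).                                                  *)
Definition path_len (X : Type) (t : X * seq X) : nat := (size t.2).+1.

(* T_v, for 1 <= v <= n *)
Definition pT (X : Type) (t : X * seq X) (v : nat) : X :=
  nth t.1 (t.1 :: t.2) v.-1.

Definition inh_weight (R : realType) (X : countType) (pi : X -> R)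
  (K : nat -> X -> X -> R) (t : X * seq X) : R :=
  pi (pT t 1) * \prod_(1 <= v < path_len t) K v (pT t v) (pT t v.+1).

(* [Vs t] = [:: V_1; V_2; ...; V_{N_n - 1}], the V_i that are <= n, where     *)
(* V_1 = 1, V_{j+1} = inf {v > V_j : T_v <> T_{v-1}}.                          *)
Definition Vs (X : eqType) (t : X * seq X) : seq nat :=
  1%N :: [seq v <- iota 2 (path_len t).-1 | pT t v != pT t v.-1].

(* V_i (1-based) *)
Definition Vi (X : eqType) (t : X * seq X) (i : nat) : nat := nth 0%N (Vs t) i.-1.

(* N_n = min {i : V_i > n} *)
Definition Nn (X : eqType) (t : X * seq X) : nat := (size (Vs t)).+1.

Definition tau (X : eqType) (t : X * seq X) (k : nat) : nat :=
  let n := path_len t in let N := Nn t in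
  if (N <= k)%N then 0%N
  else if k == 1%N then (n.+1 - Vi t N.-1)%N
  else (Vi t (N - k.-1) - Vi t (N - k))%N.

Definition Yc (X : eqType) (t : X * seq X) (k : nat) : X :=
  let n := path_len t in let N := Nn t in
  if (N <= k)%N then pT t 1
  else if k == 1%N then pT t n
  else pT t (Vi t (N - k)).

Definition Pc (R : realType) (X : eqType) (t : X * seq X) (k : nat) : R :=
  (tau t k)%:R / (path_len t)%:R.

(* first k coordinates (0-based index i stands for coordinate i+1) *)
Definition Pvec (R : realType) (X : eqType) (k : nat) (t : X * seq X) : 'rV[R]_k :=
  \row_(i < k) Pc R t i.+1.
Definition Yvec (X : eqType) (k : nat) (t : X * seq X) : 'I_k -> X :=
  fun i => Yc t i.+1.
Arguments Pvec {R X} k t.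
Arguments Yvec {X} k t _.

Definition paths_of_len (X : Type) (n : nat) : set (X * seq X) :=
  [set t | path_len t = n].

Definition inh_exp (R : realType) (X : countType) (pi : X -> R)
  (K : nat -> X -> X -> R) (n : nat) (F : X * seq X -> R) : R :=
  dsum (@paths_of_len X n) (fun t => inh_weight pi K t * F t).

Definition mc_weight (R : realType) (X : countType) (mu : X -> R)
  (K : X -> X -> R) (k : nat) (y : 'I_k -> X) : R :=
  match k return ('I_k -> X) -> R with
  | 0%N => fun _ => 1
  | k'.+1 => fun y =>
      mu (y ord0) * \prod_(j < k') K (y (inord j)) (y (inord j.+1))
  end y.

(* E[h(X)] for X ~ Beta(1, th); Beta(1,0) is the point mass at 1. *)
Definition beta1 (R : realType) (th : R) (h : R -> R) : R :=
  if 0 < th then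
    Rintegral lebesgue_measure `[0, 1]%classic
      (fun x => th * (1 - x) `^ (th - 1) * h x)
  else h 1.

(* [gem_rec ths rem acc g] : iterated expectation over independent         *)
(* X_j ~ Beta(1, th_j), with P_j = X_j * prod_{i<j} (1 - X_i);               *)
(* rem = prod_{i<j}(1 - X_i), acc = the already computed P's (reversed).     *)
Fixpoint gem_rec (R : realType) (ths : seq R) (rem : R) (acc : seq R)
  (g : seq R -> R) : R :=
  match ths with
  | [::] => g (rev acc)
  | th :: ths' =>
      beta1 th (fun x => gem_rec ths' (rem * (1 - x)) ((rem * x) :: acc) g)
  end.

Definition gem_exp (R : realType) (k : nat) (th : 'I_k -> R) (g : 'rV[R]_k -> R)
  : R :=
  gem_rec [seq th i | i <- enum 'I_k] 1 [::]
    (fun s => g (\row_(i < k) nth 0 s i)).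

Definition gem_params (R : realType) (X : countType) (G : X -> X -> R) (k : nat)
  (y : 'I_k -> X) : 'I_k -> R := fun i => - G (y i) (y i).

Definition mccgem_exp (R : realType) (X : countType) (G : X -> X -> R)
  (mu : X -> R) (k : nat) (f : 'rV[R]_k -> ('I_k -> X) -> R) : R :=
  dsum [set: {ffun 'I_k -> X}]
    (fun y => mc_weight mu (KG G) y * gem_exp (gem_params G y) (fun p => f p y)).

Definition unit_cube (R : realType) (k : nat) : set 'rV[R]_k :=
  [set p | forall i, 0 <= p ord0 i <= 1].

Definition bcont (R : realType) (k : nat) (g : 'rV[R]_k -> R) : Prop :=
  {within @unit_cube R k, continuous g} /\
  exists B : R, forall p, @unit_cube R k p -> `|g p| <= B.

(* bounded continuous functions on [0,1]^k x X^k (X^k discrete) *)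
Definition bcont2 (R : realType) (X : Type) (k : nat)
  (f : 'rV[R]_k -> ('I_k -> X) -> R) : Prop :=
  (forall y, {within @unit_cube R k, continuous (f ^~ y)}) /\
  exists B : R, forall p y, @unit_cube R k p -> `|f p y| <= B.

Definition possible_seq (R : realType) (X : countType) (mu : X -> R)
  (K : X -> X -> R) (y : nat -> X) : Prop :=
  forall k : nat, 0 < mu (y 0%N) * \prod_(j < k) K (y j) (y j.+1).

Definition mc_exp (R : realType) (X : countType) (mu : X -> R) (K : X -> X -> R)
  (k : nat) (f : ('I_k -> X) -> R) : R :=
  dsum [set: {ffun 'I_k -> X}] (fun y => mc_weight mu K y * f y).

Definition Qmat (R : realType) (X : countType) (G : X -> X -> R) (theta : R)
  (i j : X) : R := @idm R X i j + G i j / theta.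

Definition Yeq (R : realType) (X : countType) (k : nat) (y : nat -> X)
  (t : X * seq X) : R :=
  [forall i : 'I_k, Yvec k t i == y i]%:R.

(* Main.v *)
(** The chain is run forward in time. Let [b_k] be the number of times preceding the
    last [k] clumps and [W_k = b_k / b_{k-1}], so that [P_k = W_1 ... W_{k-1} (1 - W_k)].
    Passing from time [n] to [n+1] either prolongs the current clump, which multiplies
    [W_1] by [n/(n+1)], or starts a new one, which shifts the sequences [W], [Y] and puts
    [n/(n+1)] in front of [W]. Hence [s_n(y, m) = E (1{Y_1..Y_k = y} W_1^m_1 ... W_k^m_k)]
    satisfies
      [s_{n+1}(y, m) = (n/(n+1))^m_1 ((1 + G_{y_1 y_1}/n) s_n(y, m) + c_n / n)]
    where, for [k >= 2], [c_n = 1{y_1 <> y_2} G_{y_2 y_1} s_n(y_2..y_k, m_2..m_k)].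
    If [c_n --> c] such a recursion forces [s_n --> c / (m_1 - G_{y_1 y_1})], and by
    detailed balance between [G] and [G'] the resulting limit is the weight of [y] under
    the reversed chain times the moments [th / (th + m)] of the law of [1 - X], where
    [X] is Beta(1, th). Bernstein polynomials pass from monomials to continuous functions,
    and Scheffe's argument passes from a fixed [y] to sums over the countable state space.
    The marginals converge because [I + G/n = (1 - theta/n) I + (theta/n) Q]. *)

Require Import Defs.
From HB Require Import structures.
From mathcomp Require Import all_boot all_order all_algebra.
From mathcomp Require Import all_classical all_reals all_analysis.
From mathcomp Require Import measurable_realfun.
From mathcomp Require Import ring lra zify.
Import Order.TTheory GRing.Theory Num.Theory.
Import numFieldNormedType.Exports.
Set Implicit Arguments. Unset Strict Implicit. Unset Printing Implicit Defensive.
Local Open Scope classical_set_scope.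
Local Open Scope ring_scope.

(** * Recursions of harmonic type *)

(** The case [k = 1] escapes the pattern of the recursion: there [c_n] is the flow into [y_1] from
    all other states, an infinite sum. It is recovered from two marginals, at time [n] and after one
    extra step of [Q], which have the same limit. To reach the marginals from the entrywise
    convergence of [pi Q^j] alone, the chain is stopped at time [n] and continued with [j] steps of
    [Q]; the array indexed by [n] and [j] satisfies a closed recursion, and the law of the number of
    [Q]-steps is never computed. A state of [mu]-mass 0 has rate 0 under [G'], so its GEM parameter
    is not [- G y y]. Such states occur only in sequences of weight 0; the argument works with
    [- G y y > 0] throughout and corrects this at the end. The GEM law is given as an iterated
    integral, whose inner integrals must be known to be measurable in the outer variable. Polynomial
    approximation settles this along with the convergence: the inner integrals are uniform limits of
    polynomials. *)

Lemma contraction_cvg0 (R : realType) (a : R) (x e : nat -> R) : 0 < a ->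
  (\forall n \near \oo, `|x n.+1| <= (1 - a / n%:R) * `|x n| + e n / n%:R) ->
  e @ \oo --> 0 -> x @ \oo --> 0.
Proof.
move=> a0 xrec e0; apply/cvgr0Pnorm_le => eps eps0.
pose H n : R := series harmonic n.-1.
have HS n : (0 < n)%N -> H n.+1 = H n + n%:R^-1.
  by case: n => // n _; rewrite /H /= seriesSr.
have Hoo : H @ \oo --> +oo.
  rewrite -(cvg_shiftS H) /H /=.
  apply: nondecreasing_dvgn_lt; last exact: dvg_harmonic.
  by apply: nondecreasing_series => n _ _; exact: harmonic_ge0.
have ae0 : 0 < a * (eps / 2) by rewrite mulr_gt0// divr_gt0.
have /cvgr0Pnorm_le/(_ _ ae0) eN := e0.
have [N _ PN] : \forall n \near \oo, [/\ (0 < n)%N, a <= n%:R,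
    `|x n.+1| <= (1 - a / n%:R) * `|x n| + e n / n%:R & `|e n| <= a * (eps / 2)].
  near=> n; split.
  - by near: n; exists 1%N.
  - by near: n; exact: nbhs_infty_ger.
  - by near: n.
  - by near: n.
(* Once [|e n| <= a * (eps / 2)], the level [eps / 2] is preserved by the recursion, so the excess
   over it shrinks by [1 - a / n <= expR (- (a / n))]. The factors multiply to [expR (- (a * H n))],
   and the harmonic sum [H] diverges. [C] normalises the bound at [N]. *)
pose C := `|x N| * expR (a * H N).
have bnd n : (N <= n)%N -> `|x n| - eps / 2 <= C * expR (- (a * H n)).
  elim: n => [|n IH] Nn.
    move: Nn; rewrite leqn0 => /eqP N0; rewrite /C -mulrA -expRD N0 subrr expR0.
    by rewrite mulr1 lerBlDr lerDl; lra.
  case: (ltngtP N n.+1) Nn => // [|<- _]; last first.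
    by rewrite /C -mulrA -expRD subrr expR0 mulr1 lerBlDr lerDl; lra.
  rewrite ltnS => Nn _; have [n0 an xn en] := PN _ Nn.
  have nR : 0 < n%:R :> R by rewrite ltr0n.
  have an1 : a / n%:R <= 1 by rewrite ler_pdivrMr// mul1r.
  have enn : e n / n%:R <= a / n%:R * (eps / 2).
    rewrite mulrAC ler_pM2r ?invr_gt0//.
    by apply: le_trans en; exact: ler_norm.
  have h1 : `|x n.+1| - eps / 2 <= (1 - a / n%:R) * (`|x n| - eps / 2) by lra.
  apply: (le_trans h1).
  have -> : - (a * H n.+1) = - (a * H n) - a / n%:R by rewrite HS//; ring.
  rewrite expRD mulrA [leRHS]mulrC.
  apply: (@le_trans _ _ ((1 - a / n%:R) * (C * expR (- (a * H n))))).
    by apply: ler_wpM2l; [lra | exact: IH].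
  apply: ler_wpM2r; first by rewrite mulr_ge0// ?expR_ge0// mulr_ge0 ?expR_ge0.
  by have := expR_ge1Dx (- (a / n%:R)); lra.
have C0 : C * expR (- (a * H n)) @[n --> \oo] --> 0.
  rewrite -[X in _ --> X](mulr0 C); apply: cvgM; first exact: cvg_cst.
  have aH : a * H n @[n --> \oo] --> +oo; first by apply: (@gt0_cvgMry R (H @ \oo) _ a id).
  exact: (cvg_comp _ _ aH (@cvgr_expR R)).
have e20 : 0 < eps / 2 by lra.
have /cvgr0Pnorm_le/(_ _ e20) := C0.
apply: filterS2 (nbhs_infty_ge N) => n Nn CH.
have := bnd _ Nn; have := ler_norm (C * expR (- (a * H n))); lra.
Unshelve. all: by end_near. Qed.

(** This is the derivative of [u ^+ m] at 1 along the increments [- 1 / (n + 1)]; it produces the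
    [m] in the denominator of the limiting moments. *)
Lemma cvg_ratio_expn (R : realType) (m : nat) :
  n%:R * ((n%:R / n.+1%:R : R) ^+ m - 1) @[n --> \oo] --> (- m%:R : R).
Proof.
have r1 : (n%:R / n.+1%:R : R) @[n --> \oo] --> (1 : R).
  have -> : (fun n => n%:R / n.+1%:R : R) = (fun n => 1 - harmonic n).
    apply/funext => n /=; have : n.+1%:R != 0 :> R by rewrite pnatr_eq0.
    by rewrite -natr1 => ?; field.
  rewrite -[X in _ --> X]subr0; apply: cvgB; [exact: cvg_cst|exact: cvg_harmonic].
elim: m => [|m IH].
  under eq_cvg do rewrite expr0 subrr mulr0.
  by rewrite oppr0; exact: cvg_cst.
have -> : (fun n => n%:R * ((n%:R / n.+1%:R : R) ^+ m.+1 - 1)) =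
    (fun n => n%:R / n.+1%:R * (n%:R * ((n%:R / n.+1%:R : R) ^+ m - 1)) - n%:R / n.+1%:R).
  apply/funext => n; have : n.+1%:R != 0 :> R by rewrite pnatr_eq0.
  rewrite exprS -natr1 => n0; set z := (_ / _) ^+ m; by field.
rewrite -natr1 opprD -[X in _ --> X - _]mul1r; apply: cvgB => //.
by apply: cvgM.
Qed.

(** To first order in [1 / n] the increment of [x] is [(l - (a + m) x) / n], which vanishes at [L].
    Subtracting [L] leaves a contraction whose source [e] tends to [- m L + (l - a L) = 0]. *)
Lemma recursion_cvg (R : realType) (a l : R) (m : nat) (x c : nat -> R) : 0 < a ->
  (\forall n \near \oo, x n.+1 =
     (n%:R / n.+1%:R) ^+ m * ((1 - a / n%:R) * x n + c n / n%:R)) ->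
  c @ \oo --> l -> x @ \oo --> l / (a + m%:R).
Proof.
move=> a0 xrec cl.
have am0 : a + m%:R != 0 by rewrite gt_eqF// ltr_wpDr.
set L := l / _.
pose r n : R := (n%:R / n.+1%:R) ^+ m.
pose e n : R := `|n%:R * (r n - 1) * L + r n * (c n - a * L)|.
have r1 : r @ \oo --> (1 : R).
  have := @cvg_ratio_expn R m => h.
  have h0 : (fun n => harmonic n.-1 * (n%:R * (r n - 1)) + 1) @ \oo --> (1 : R).
    rewrite -[X in _ --> X]add0r -[X in _ --> X + _](mul0r (- m%:R)).
    apply: cvgD; last exact: cvg_cst.
    apply: cvgM => //; rewrite -(cvg_shiftS (fun n => harmonic n.-1 : R)); exact: cvg_harmonic.
  apply: cvg_trans h0; apply: near_eq_cvg; near=> n.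
  have n0 : (0 < n)%N by near: n; exists 1%N.
  by rewrite /= prednK// mulKf ?subrK// pnatr_eq0 -lt0n.
have e0 : e @ \oo --> 0.
  apply/norm_cvg0P.
  have -> : 0 = - m%:R * L + 1 * (l - a * L) :> R by rewrite /L; field.
  apply: cvgD; apply: cvgM => //; first exact: cvg_ratio_expn.
  - exact: cvg_cst.
  - by apply: cvgB => //; exact: cvg_cst.
suff : (fun n => x n - L) @ \oo --> 0.
  move=> h; have -> : x = (fun n => (x n - L) + L) by apply/funext => n; rewrite subrK.
  by rewrite -[X in _ --> X]add0r; apply: cvgD => //; exact: cvg_cst.
apply: (contraction_cvg0 a0 _ e0).
near=> n.
have n0 : (0 < n)%N by near: n; exists 1%N.
have nR : 0 < n%:R :> R by rewrite ltr0n.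
have an : a / n%:R <= 1.
  by rewrite ler_pdivrMr// mul1r; near: n; exact: nbhs_infty_ger.
have -> : x n.+1 = r n * ((1 - a / n%:R) * x n + c n / n%:R) by near: n.
have -> : r n * ((1 - a / n%:R) * x n + c n / n%:R) - L =
   r n * (1 - a / n%:R) * (x n - L) + (n%:R * (r n - 1) * L + r n * (c n - a * L)) / n%:R.
  by field; rewrite gt_eqF.
apply: (le_trans (ler_normD _ _)); rewrite /e normrM [X in _ + X]normrM.
have rn0 : 0 <= r n by rewrite exprn_ge0// divr_ge0.
have rn1 : r n <= 1.
  by rewrite exprn_ile1// ?divr_ge0// ler_pdivrMr// mul1r ler_nat.
rewrite [`|n%:R^-1|]gtr0_norm ?invr_gt0// lerD2r ler_wpM2r// ger0_norm.
  by rewrite ler_piMl// subr_ge0.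
by rewrite mulr_ge0// subr_ge0.
Unshelve. all: by end_near. Qed.

(** Meant for [A n j] the probability of being at [y] after [n] times of the chain and [j] further
    steps of [Q]. The limit along one row is transferred to every column, because the recursion
    keeps pushing towards larger [j]. *)
Lemma array_cvg (R : realType) (th L : R) (A : nat -> nat -> R) (n0 : nat) : 0 < th ->
  (forall n j, (n0 <= n)%N -> A n.+1 j = (1 - th / n%:R) * A n j + th / n%:R * A n j.+1) ->
  A n0 @ \oo --> L -> forall j, A^~ j @ \oo --> L.
Proof.
move=> th0 Arec AL.
have AnL n : (n0 <= n)%N -> A n @ \oo --> L.
  elim: n => [|n IH]; first by rewrite leqn0 => /eqP n00; rewrite -n00.
  case: (ltngtP n0 n.+1) => // [|<- //]; rewrite ltnS => n0n _.
  have -> : A n.+1 = (fun j => (1 - th / n%:R) * A n j + th / n%:R * A n j.+1).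
    by apply/funext => j; exact: Arec.
  have -> : L = (1 - th / n%:R) * L + th / n%:R * L by ring.
  apply: cvgD; apply: cvgM; [exact: cvg_cst|exact: IH|exact: cvg_cst|].
  by rewrite (cvg_shiftS (A n)); exact: IH.
(* While [n < th] the coefficient [1 - th / n] is negative. The row limit survives these finitely
   many steps, and from [n1] on the recursion is a convex combination. *)
pose n1 := maxn n0 (Num.truncn th).+1.
have n1n0 : (n0 <= n1)%N by exact: leq_maxl.
have n1th n : (n1 <= n)%N -> th <= n%:R.
  move=> nn; apply: ltW; apply: (lt_le_trans (truncnS_gt _)).
  by rewrite ler_nat; apply: leq_trans nn; exact: leq_maxr.
move=> j; apply/cvgrPdist_le => eps eps0.
have e20 : 0 < eps / 2 by rewrite divr_gt0.
(* The excess of the error over eps / 2 vanishes for j >= J and satisfies a convex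
   recursion, so it tends to 0 for every j by downward induction from J. *)
pose D n j : R := Num.max (`|A n j - L| - eps / 2) 0.
have D0 n i : 0 <= D n i by rewrite le_max lexx orbT.
have Drec n i : (n1 <= n)%N -> D n.+1 i <= (1 - th / n%:R) * D n i + th / n%:R * D n i.+1.
  move=> nn; have n0n := leq_trans n1n0 nn.
  have nR : 0 < n%:R :> R by exact: lt_le_trans th0 (n1th _ nn).
  have t1 : th / n%:R <= 1 by rewrite ler_pdivrMr// mul1r n1th.
  have t0 : 0 <= th / n%:R by rewrite divr_ge0// ltW.
  have t2 : 0 <= 1 - th / n%:R by rewrite subr_ge0.
  have m1 := mulr_ge0 t2 (D0 n i); have m2 := mulr_ge0 t0 (D0 n i.+1).
  rewrite {1}/D ge_max; apply/andP; split; last by lra.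
  rewrite Arec// .
  have -> : (1 - th / n%:R) * A n i + th / n%:R * A n i.+1 - L =
     (1 - th / n%:R) * (A n i - L) + th / n%:R * (A n i.+1 - L) by ring.
  have := ler_normD ((1 - th / n%:R) * (A n i - L)) (th / n%:R * (A n i.+1 - L)).
  have nM (u v : R) : 0 <= u -> `|u * v| = u * `|v| by move=> u0; rewrite normrM ger0_norm.
  rewrite (nM _ _ t2) (nM _ _ t0).
  have d1 : (1 - th / n%:R) * (`|A n i - L| - eps / 2) <= (1 - th / n%:R) * D n i.
    by apply: ler_wpM2l => //; rewrite le_max lexx.
  have d2 : th / n%:R * (`|A n i.+1 - L| - eps / 2) <= th / n%:R * D n i.+1.
    by apply: ler_wpM2l => //; rewrite le_max lexx.
  lra.
have [J _ HJ] : \forall i \near \oo, `|L - A n1 i| <= eps / 2.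
  by have /cvgrPdist_le/(_ _ e20) := AnL _ n1n0.
have DJ n i : (n1 <= n)%N -> (J <= i)%N -> D n i = 0.
  elim: n i => [|n IH] i.
    rewrite leqn0 => /eqP n10 Ji; apply/eqP; rewrite eq_le D0 andbT ge_max lexx andbT.
    by rewrite subr_le0 distrC; have := HJ i Ji; rewrite /= n10.
  case: (ltngtP n1 n.+1) => // [|<- _ Ji]; last first.
    apply/eqP; rewrite eq_le D0 andbT ge_max lexx andbT.
    by rewrite subr_le0 distrC; exact: HJ.
  rewrite ltnS => nn _ Ji; apply/eqP; rewrite eq_le D0 andbT.
  apply: (le_trans (Drec _ _ nn)); rewrite !IH// ?mulr0 ?addr0//.
  exact: leq_trans (leqnSn _).
have Dcvg i : D^~ i @ \oo --> 0.
  have [k] := ubnP (J - i); elim: k i => // k IH i Jik.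
  have [Ji|iJ] := leqP J i.
    apply: (cvg_trans _ (@cvg_cst R 0 nat \oo _)).
    by apply: near_eq_cvg; exists n1 => // n /= nn; rewrite DJ.
  apply: (@contraction_cvg0 _ th _ (fun n => th * D n i.+1)) => //.
    exists n1 => // n /= nn; rewrite !ger0_norm//.
    by apply: (le_trans (Drec _ _ nn)); rewrite mulrAC.
  rewrite -[X in _ --> X](mulr0 th); apply: cvgM; first exact: cvg_cst.
  by apply: IH; lia.
have /cvgr0Pnorm_le/(_ _ e20) := Dcvg j.
apply: filterS => n; rewrite ger0_norm// ge_max => /andP[h _].
by rewrite distrC; lra.
Unshelve. all: by end_near. Qed.

(** * Absolutely convergent discrete sums *)

Definition dsummable (R : realType) (T : choiceType) (D : set T) (a : T -> R) : Prop :=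
  (\esum_(x in D) `|a x|%:E < +oo)%E.

Section dsum_theory.
Variables (R : realType) (T : choiceType) (D : set T).
Implicit Types a b p q : T -> R.

Lemma dsummable_le a b : (forall x, D x -> `|a x| <= b x) ->
  (\esum_(x in D) (b x)%:E < +oo)%E -> dsummable D a.
Proof. by move=> ab; apply: le_lt_trans; apply: le_esum => x Dx; rewrite lee_fin ab. Qed.

Lemma ge0_dsummable a : (forall x, D x -> 0 <= a x) ->
  (\esum_(x in D) (a x)%:E < +oo)%E -> dsummable D a.
Proof. by move=> a0; apply: dsummable_le => x Dx; rewrite ger0_norm ?a0. Qed.

Lemma ge0_esumZ (c : R) a : 0 <= c -> (forall x, D x -> 0 <= a x) ->
  (\esum_(x in D) (c * a x)%:E = c%:E * \esum_(x in D) (a x)%:E)%E.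
Proof.
have le1 (k : R) b : 0 <= k -> (forall x, D x -> 0 <= b x) ->
    (\esum_(x in D) (k * b x)%:E <= k%:E * \esum_(x in D) (b x)%:E)%E.
  move=> k0 b0; apply: ge_ereal_sup => _ [A [finA AD] <-].
  have -> : (\sum_(x \in A) (k * b x)%:E = k%:E * \sum_(x \in A) (b x)%:E)%E.
    by rewrite !fsbig_finite// !sumEFin -EFinM mulr_sumr.
  by apply: lee_wpmul2l; [rewrite lee_fin | apply: ereal_sup_ubound; exists A].
move=> c0 a0; apply/eqP; rewrite eq_le le1//=.
have [->|cn0] := eqVneq c 0.
  by rewrite mul0e; apply: esum_ge0 => x _; rewrite mul0r.
have {cn0}c0 : 0 < c by rewrite lt_def cn0.
rewrite muleC -lee_pdivlMr// muleC.
apply: le_trans (le1 c^-1 _ _ _); last 2 first.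
  by rewrite invr_ge0 ltW.
  by move=> x Dx; rewrite mulr_ge0 ?a0// ltW.
by apply: le_esum => x _; rewrite mulKf// gt_eqF.
Qed.

Lemma dsummableZ (c : R) a : dsummable D a -> dsummable D (fun x => c * a x).
Proof.
move=> sa; rewrite /dsummable.
rewrite (_ : \esum_(x in D) _ = \esum_(x in D) (`|c| * `|a x|)%:E)%E.
  rewrite ge0_esumZ// lte_mul_pinfty//.
by apply: eq_esum => x _; rewrite normrM.
Qed.

Lemma ge0_esum_fin a : (forall x, D x -> 0 <= a x) ->
  (\esum_(x in D) (a x)%:E < +oo)%E -> (\esum_(x in D) (a x)%:E)%E \is a fin_num.
Proof. by move=> a0 aoo; rewrite ge0_fin_numE// esum_ge0. Qed.

(** [dsum] is defined by the positive and negative parts, which are not additive; freedom in the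
    choice of the splitting is what yields linearity. *)
Lemma dsum_diff a p q : (forall x, D x -> 0 <= p x) -> (forall x, D x -> 0 <= q x) ->
  (\esum_(x in D) (p x)%:E < +oo)%E -> (\esum_(x in D) (q x)%:E < +oo)%E ->
  (forall x, D x -> a x = p x - q x) ->
  dsum D a = fine (\esum_(x in D) (p x)%:E) - fine (\esum_(x in D) (q x)%:E).
Proof.
move=> p0 q0 poo qoo apq.
have sp : summable D (EFin \o p) by exact: ge0_dsummable.
have sq : summable D (EFin \o q) by exact: ge0_dsummable.
have := esumB sp sq p0 q0.
rewrite /= => /(congr1 fine).
have e1 : (\esum_(x in D) ((EFin \o p) \- (EFin \o q))^\+ x = \esum_(x in D) (Num.max (a x) 0)%:E)%E.
  by apply: eq_esum => x Dx; rewrite funeposE/= EFin_max apq.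
have e2 : (\esum_(x in D) ((EFin \o p) \- (EFin \o q))^\- x = \esum_(x in D) (Num.max (- a x) 0)%:E)%E.
  by apply: eq_esum => x Dx; rewrite funenegE/= EFin_max apq.
have f1 : (\esum_(x in D) (Num.max (a x) 0)%:E)%E \is a fin_num.
  apply: ge0_esum_fin => [x _|]; first by rewrite le_max lexx orbT.
  apply: le_lt_trans poo; apply: le_esum => x Dx.
  by rewrite lee_fin ge_max p0// apq// lerBlDr lerDl q0.
have f2 : (\esum_(x in D) (Num.max (- a x) 0)%:E)%E \is a fin_num.
  apply: ge0_esum_fin => [x _|]; first by rewrite le_max lexx orbT.
  apply: le_lt_trans qoo; apply: le_esum => x Dx.
  by rewrite lee_fin ge_max q0// apq// opprB lerBlDr lerDl p0.
by rewrite e1 e2 !fineB// ?ge0_esum_fin.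
Qed.

Lemma eq_dsum a b : (forall x, D x -> a x = b x) -> dsum D a = dsum D b.
Proof.
move=> ab; rewrite /dsum; congr (fine _ - fine _); apply: eq_esum => x Dx; by rewrite ab.
Qed.

Lemma ge0_dsum a : (forall x, D x -> 0 <= a x) -> dsum D a = fine (\esum_(x in D) (a x)%:E).
Proof.
move=> a0; rewrite /dsum [X in _ - fine X]esum1 ?subr0.
  by congr fine; apply: eq_esum => x Dx; rewrite max_l// a0.
by move=> x Dx; rewrite max_r// oppr_le0 a0.
Qed.

Lemma ge0_dsumE a : (forall x, D x -> 0 <= a x) -> (\esum_(x in D) (a x)%:E < +oo)%E ->
  ((dsum D a)%:E = \esum_(x in D) (a x)%:E)%E.
Proof. by move=> a0 aoo; rewrite ge0_dsum// fineK// ge0_esum_fin. Qed.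

Let pos a x := Num.max (a x) 0.
Let neg a x := Num.max (- a x) 0.
Let posneg a x : a x = pos a x - neg a x.
Proof. by rewrite /pos/neg; case: (lerP (a x) 0); case: (lerP (- a x) 0); lra. Qed.
Let pos0 a x : 0 <= pos a x. Proof. by rewrite le_max lexx orbT. Qed.
Let neg0 a x : 0 <= neg a x. Proof. by rewrite le_max lexx orbT. Qed.
Let posoo a : dsummable D a -> (\esum_(x in D) (pos a x)%:E < +oo)%E.
Proof. by apply: le_lt_trans; apply: le_esum => x _; rewrite lee_fin ge_max ler_norm normr_ge0. Qed.
Let negoo a : dsummable D a -> (\esum_(x in D) (neg a x)%:E < +oo)%E.
Proof.
apply: le_lt_trans; apply: le_esum => x _.
by rewrite lee_fin ge_max normr_ge0 -normrN ler_norm.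
Qed.

Let posf a : dsummable D a -> (\esum_(x in D) (pos a x)%:E)%E \is a fin_num.
Proof. by move=> sa; apply: ge0_esum_fin (posoo sa) => x _; exact: pos0. Qed.
Let negf a : dsummable D a -> (\esum_(x in D) (neg a x)%:E)%E \is a fin_num.
Proof. by move=> sa; apply: ge0_esum_fin (negoo sa) => x _; exact: neg0. Qed.

Lemma dsumD a b : dsummable D a -> dsummable D b ->
  dsum D (fun x => a x + b x) = dsum D a + dsum D b.
Proof.
move=> sa sb.
rewrite (@dsum_diff _ (fun x => pos a x + pos b x) (fun x => neg a x + neg b x)).
- under eq_esum do rewrite EFinD.
  under [X in _ - fine X]eq_esum do rewrite EFinD.
  rewrite !esumD; [|by move=> *; rewrite lee_fin..].
  rewrite (fineD (posf sa) (posf sb)) (fineD (negf sa) (negf sb)).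
  by rewrite /dsum -!/(pos _ _) -!/(neg _ _) opprD addrACA.
- by move=> x _; rewrite addr_ge0.
- by move=> x _; rewrite addr_ge0.
- under eq_esum do rewrite EFinD.
  rewrite esumD; [|by move=> *; rewrite lee_fin..].
  by apply: lte_add_pinfty; exact: posoo.
- under eq_esum do rewrite EFinD.
  rewrite esumD; [|by move=> *; rewrite lee_fin..].
  by apply: lte_add_pinfty; exact: negoo.
- by move=> x _; rewrite {1}(posneg a) {1}(posneg b) opprD addrACA.
Qed.

Lemma dsumN a : dsum D (fun x => - a x) = - dsum D a.
Proof.
by rewrite /dsum opprB; under [X in _ - fine X]eq_esum do rewrite opprK.
Qed.

Lemma dsumZ (c : R) a : dsummable D a -> dsum D (fun x => c * a x) = c * dsum D a.
Proof.
wlog c0 : c / 0 <= c => [hw sa|].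
  have [/hw->//|c0] := leP 0 c.
  have -> : (fun x => c * a x) = (fun x => - (- c * a x)) by apply/funext => x; rewrite mulNr opprK.
  by rewrite dsumN hw// ?mulNr ?opprK// oppr_ge0 ltW.
move=> sa.
rewrite (@dsum_diff _ (fun x => c * pos a x) (fun x => c * neg a x)).
- rewrite !ge0_esumZ// (fineM _ (posf sa))// (fineM _ (negf sa))//.
  by rewrite -mulrBr.
- by move=> x _; rewrite mulr_ge0.
- by move=> x _; rewrite mulr_ge0.
- by rewrite ge0_esumZ// lte_mul_pinfty ?lee_fin// posoo.
- by rewrite ge0_esumZ// lte_mul_pinfty ?lee_fin// negoo.
- by move=> x _; rewrite {1}(posneg a) mulrBr.
Qed.

Lemma ler_dsum a b : dsummable D a -> dsummable D b -> (forall x, D x -> a x <= b x) ->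
  dsum D a <= dsum D b.
Proof.
move=> sa sb ab; rewrite /dsum; apply: lerB; apply: fine_le.
- exact: posf.
- exact: posf.
- by apply: le_esum => x Dx; rewrite lee_fin ge_max !le_max lexx orbT ab.
- exact: negf.
- exact: negf.
- by apply: le_esum => x Dx; rewrite lee_fin ge_max !le_max lexx orbT lerN2 ab.
Qed.

Lemma dsum_ge0 a : (forall x, D x -> 0 <= a x) -> 0 <= dsum D a.
Proof.
by move=> a0; rewrite ge0_dsum// fine_ge0// esum_ge0// => x Dx; rewrite lee_fin a0.
Qed.

Lemma dsum_delta y a : D y -> (forall x, D x -> x != y -> a x = 0) -> dsum D a = a y.
Proof.
move=> Dy a0.
have h (b : T -> R) : (forall x, D x -> x != y -> b x = 0) -> (forall x, D x -> 0 <= b x) ->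
    (\esum_(x in D) (b x)%:E = (b y)%:E)%E.
  move=> b0 bge; rewrite (esumID [set y])/=; last by move=> x Dx; rewrite lee_fin bge.
  rewrite [X in (_ + X)%E]esum1 ?adde0.
    by rewrite setI1 mem_set// esum_set1// lee_fin bge.
  by move=> x [Dx /= /eqP xy]; rewrite b0.
have h1 : (\esum_(x in D) (pos a x)%:E = (pos a y)%:E)%E.
  by apply: h => [x Dx xy|x _]; [rewrite /pos a0// maxxx | exact: pos0].
have h2 : (\esum_(x in D) (neg a x)%:E = (neg a y)%:E)%E.
  by apply: h => [x Dx xy|x _]; [rewrite /neg a0// oppr0 maxxx | exact: neg0].
by rewrite /dsum h1 h2 -posneg.
Qed.

End dsum_theory.

(** * Inhomogeneous chains *)

Definition wmean (R : realType) (T : choiceType) (D : set T) (w F : T -> R) : R :=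
  dsum D (fun t => w t * F t).

Definition bdd_on (R : realType) (T : choiceType) (D : set T) (F : T -> R) : Prop :=
  exists B : R, forall t, D t -> `|F t| <= B.

Definition pmf_on (R : realType) (T : choiceType) (D : set T) (w : T -> R) : Prop :=
  (forall t, D t -> 0 <= w t) /\ (\esum_(t in D) (w t)%:E = 1)%E.

Section weighted_mean.
Variables (R : realType) (T : choiceType) (D : set T).
Implicit Types F H : T -> R.

Lemma bdd_on_cst (c : R) : bdd_on D (fun=> c).
Proof. by exists `|c|. Qed.

Lemma bdd_onD F H : bdd_on D F -> bdd_on D H -> bdd_on D (fun t => F t + H t).
Proof.
move=> [B hB] [C hC]; exists (B + C) => t Dt.
by rewrite (le_trans (ler_normD _ _))// lerD ?hB ?hC.
Qed.

Lemma bdd_onM F H : bdd_on D F -> bdd_on D H -> bdd_on D (fun t => F t * H t).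
Proof.
move=> [B hB] [C hC]; exists (B * C) => t Dt.
by rewrite normrM ler_pM ?hB ?hC.
Qed.

Lemma bdd_onZ (c : R) F : bdd_on D F -> bdd_on D (fun t => c * F t).
Proof. by apply: bdd_onM; exact: bdd_on_cst. Qed.

Lemma bdd_on_sum (I : Type) (r : seq I) (F : I -> T -> R) :
  (forall i, bdd_on D (F i)) -> bdd_on D (fun t => \sum_(i <- r) F i t).
Proof.
move=> bF; elim: r => [|i r IH].
  by rewrite (_ : (fun _ => _) = fun=> 0); [exact: bdd_on_cst | apply/funext => t; rewrite big_nil].
rewrite (_ : (fun _ => _) = fun t => F i t + \sum_(i <- r) F i t); last first.
  by apply/funext => t; rewrite big_cons.
exact: bdd_onD.
Qed.

Variables (w : T -> R) (wP : pmf_on D w).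

Lemma wmean_summable F : bdd_on D F -> dsummable D (fun t => w t * F t).
Proof.
move=> [B hB]; case: wP => w0 w1.
have [D0|/set0P[t0 Dt0]] := eqVneq D set0; last first.
  have B0 : 0 <= B by exact: le_trans (hB _ Dt0).
  apply: (@dsummable_le _ _ _ _ (fun t => B * w t)).
    by move=> t Dt; rewrite normrM (ger0_norm (w0 _ Dt)) mulrC ler_wpM2r ?w0 ?hB.
  by rewrite ge0_esumZ// w1 mule1 ltry.
by rewrite /dsummable D0 esum_set0 ltry.
Qed.

Lemma eq_wmean F H : (forall t, D t -> F t = H t) -> wmean D w F = wmean D w H.
Proof. by move=> FH; apply: eq_dsum => t Dt; rewrite FH. Qed.

Lemma wmeanD F H : bdd_on D F -> bdd_on D H ->
  wmean D w (fun t => F t + H t) = wmean D w F + wmean D w H.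
Proof.
move=> bF bH; rewrite /wmean -dsumD; [|exact: wmean_summable..].
by apply: eq_dsum => t _; rewrite mulrDr.
Qed.

Lemma wmeanZ (c : R) F : bdd_on D F -> wmean D w (fun t => c * F t) = c * wmean D w F.
Proof.
move=> bF; rewrite /wmean -dsumZ; last exact: wmean_summable.
by apply: eq_dsum => t _; rewrite mulrCA.
Qed.

Lemma wmeanB F H : bdd_on D F -> bdd_on D H ->
  wmean D w (fun t => F t - H t) = wmean D w F - wmean D w H.
Proof.
move=> bF bH; rewrite -mulN1r -wmeanZ// -wmeanD//; last exact: bdd_onZ.
by apply: eq_wmean => t _; rewrite mulN1r.
Qed.

Lemma wmean_cst (c : R) : wmean D w (fun=> c) = c.
Proof.
rewrite -[X in wmean _ _ (fun=> X)]mulr1 wmeanZ; last exact: bdd_on_cst.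
case: wP => w0 w1; rewrite /wmean ge0_dsum; last by move=> t Dt; rewrite mulr1 w0.
by under eq_esum do rewrite mulr1; rewrite w1 mulr1.
Qed.

Lemma ler_wmean F H : bdd_on D F -> bdd_on D H -> (forall t, D t -> F t <= H t) ->
  wmean D w F <= wmean D w H.
Proof.
move=> bF bH FH; apply: ler_dsum; [exact: wmean_summable..|].
by move=> t Dt; case: wP => w0 _; rewrite ler_wpM2l ?w0 ?FH.
Qed.

Lemma wmean_ge0 F : (forall t, D t -> 0 <= F t) -> 0 <= wmean D w F.
Proof. by move=> F0; apply: dsum_ge0 => t Dt; case: wP => w0 _; rewrite mulr_ge0 ?w0 ?F0. Qed.

Lemma ler_norm_wmean F H : bdd_on D H -> (forall t, D t -> `|F t| <= H t) ->
  `|wmean D w F| <= wmean D w H.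
Proof.
move=> bH FH.
have bF : bdd_on D F.
  case: bH => B hB; exists B => t Dt; apply: le_trans (FH _ Dt) _.
  exact: le_trans (ler_norm _) (hB _ Dt).
rewrite ler_norml -mulN1r -wmeanZ//; apply/andP; split; apply: ler_wmean => //.
- exact: bdd_onZ.
- by move=> t Dt; rewrite mulN1r; have := FH _ Dt; rewrite ler_norml => /andP[].
- by move=> t Dt; have := FH _ Dt; rewrite ler_norml => /andP[].
Qed.

Lemma wmean_sum (I : Type) (r : seq I) (F : I -> T -> R) : (forall i, bdd_on D (F i)) ->
  wmean D w (fun t => \sum_(i <- r) F i t) = \sum_(i <- r) wmean D w (F i).
Proof.
move=> bF; elim: r => [|i r IH].
  by rewrite big_nil -[RHS]wmean_cst; apply: eq_wmean => t _; rewrite big_nil.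
rewrite big_cons -IH -wmeanD//; last exact: bdd_on_sum.
by apply: eq_wmean => t _; rewrite big_cons.
Qed.

Lemma ge0_wmeanE F : bdd_on D F -> (forall t, D t -> 0 <= F t) ->
  ((wmean D w F)%:E = \esum_(t in D) (w t * F t)%:E)%E.
Proof.
move=> bF F0; case: (wP) => w0 _.
have wF0 t : D t -> 0 <= w t * F t by move=> Dt; rewrite mulr_ge0 ?w0 ?F0.
rewrite ge0_dsumE//; apply: le_lt_trans (wmean_summable bF).
by apply: le_esum => t Dt; rewrite ger0_norm ?wF0.
Qed.

End weighted_mean.

Lemma pmf_on_le1 (R : realType) (T : choiceType) (p : T -> R) x : pmf_on [set: T] p -> p x <= 1.
Proof.
move=> [p0 p1]; rewrite -lee_fin -p1 (esumID [set x]); last by move=> y _; rewrite lee_fin p0.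
by rewrite setTI esum_set1 ?lee_fin ?p0// leeDl// esum_ge0// => y _; rewrite lee_fin p0.
Qed.

Definition stochastic (R : realType) (X : countType) (K : X -> X -> R) : Prop :=
  forall i, pmf_on [set: X] (K i).

Definition path_ext (X : Type) (t : X * seq X) (z : X) : X * seq X := (t.1, rcons t.2 z).

Definition path_end (X : Type) (t : X * seq X) : X := last t.1 t.2.

Section path_ext.
Variable X : Type.
Implicit Types (t : X * seq X) (z : X).

Lemma path_len_ext t z : path_len (path_ext t z) = (path_len t).+1.
Proof. by rewrite /path_len size_rcons. Qed.

Lemma pT_ext t z v : (v <= path_len t)%N -> pT (path_ext t z) v = pT t v.
Proof.
move=> vt; rewrite /pT /path_ext/= -rcons_cons nth_rcons /=.
by case: ifP => //; rewrite /path_len in vt; case: v vt => //= v ->.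
Qed.

Lemma pT_ext_len t z : pT (path_ext t z) (path_len t).+1 = z.
Proof. by rewrite /pT /path_ext /path_len/= nth_rcons ltnn eqxx. Qed.

Lemma pT_len t : pT t (path_len t) = path_end t.
Proof. by rewrite /pT /path_len /path_end/= -[RHS](@nth_last _ t.1) /= ; case: t.2. Qed.

Lemma path_end_ext t z : path_end (path_ext t z) = z.
Proof. by rewrite /path_end/= last_rcons. Qed.

End path_ext.

Section inhomogeneous_chain.
Variables (R : realType) (X : countType) (pi : X -> R) (K : nat -> X -> X -> R).
Hypothesis piP : pmf_on [set: X] pi.
Hypothesis KP : forall v, (0 < v)%N -> stochastic (K v).

Let D n := @paths_of_len X n.
Let w := inh_weight pi K.

Lemma inh_weight_ext t z : w (path_ext t z) = w t * K (path_len t) (path_end t) z.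
Proof.
rewrite /w /inh_weight path_len_ext big_nat_recr//= mulrA.
rewrite !(pT_ext _ (leqnn _)) pT_len pT_ext_len (@pT_ext _ _ _ 1)//; congr (_ * _ * _).
by apply: eq_big_nat => v /andP[_ vt]; rewrite !pT_ext// ltnW.
Qed.

Lemma inh_weight_ge0 t : 0 <= w t.
Proof.
case: piP => p0 _; rewrite /w /inh_weight mulr_ge0 ?p0// big_nat_cond prodr_ge0// => v.
by rewrite andbT => /andP[v0 _]; case: (KP v0 (pT t v)) => k0 _; rewrite k0.
Qed.

Lemma esum_path_ext n (a : X * seq X -> R) : (forall t, 0 <= a t) -> (0 < n)%N ->
  (\esum_(t in D n.+1) (a t)%:E =
   \esum_(t in D n) \esum_(z in [set: X]) (a (path_ext t z))%:E)%E.
Proof.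
move=> a0 n0; rewrite esum_esum; last by move=> *; rewrite lee_fin.
rewrite (@reindex_esum _ _ _ (D n `*`` (fun=> [set: X])) _ (fun k => path_ext k.1 k.2))//.
split.
- by move=> [t z] [/= tn _]; rewrite /D /paths_of_len /= path_len_ext tn.
- move=> [[x s] z] [[x' s'] z'] _ _ [/= -> /rcons_inj[-> ->]]//.
- move=> [x s] /=; rewrite /D/paths_of_len/= => -[sn].
  case/lastP: s sn => [/= n1|s z]; first by rewrite -n1 in n0.
  by rewrite size_rcons => sn; exists ((x, s), z).
Qed.

Lemma esum_paths1 (a : X * seq X -> R) :
  (\esum_(t in D 1) (a t)%:E = \esum_(x in [set: X]) (a (x, [::]))%:E)%E.
Proof.
rewrite (@reindex_esum _ _ _ [set: X] _ (fun x => (x, [::])))//.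
split => //.
- by move=> x y _ _ [->].
- by move=> [x [|y s]] // _; exists x.
Qed.

Lemma inh_pmf n : (0 < n)%N -> pmf_on (D n) w.
Proof.
move=> n0; split; first by move=> t _; exact: inh_weight_ge0.
case: n n0 => // n _; elim: n => [|n IH].
  rewrite esum_paths1; case: piP => _ <-; apply: eq_esum => x _.
  by rewrite /w /inh_weight /path_len /= big_geq// mulr1.
rewrite esum_path_ext//; last exact: inh_weight_ge0.
rewrite -IH; apply: eq_esum => t Dt.
under eq_esum do rewrite inh_weight_ext.
have [k0 k1] := @KP (path_len t) isT (path_end t).
by rewrite ge0_esumZ ?inh_weight_ge0// k1 mule1.
Qed.

(** The Markov property at time [n]. Nonnegativity of [F] lets the sum over paths be split in the
    extended reals, without summability conditions. *)
Lemma wmean_step n (F : X * seq X -> R) : (0 < n)%N -> (exists B, forall t, `|F t| <= B) ->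
  (forall t, 0 <= F t) ->
  wmean (D n.+1) w F =
  wmean (D n) w (fun t => wmean [set: X] (K n (path_end t)) (fun z => F (path_ext t z))).
Proof.
move=> n0 [B FB] F0.
have bF (T : choiceType) (E : set T) (g : T -> X * seq X) : bdd_on E (F \o g).
  by exists B => ? _; exact: FB.
have inner t : 0 <= wmean [set: X] (K n (path_end t)) (fun z => F (path_ext t z)) <= B.
  have KP' := KP n0 (path_end t).
  rewrite wmean_ge0//= -[leRHS](wmean_cst KP'); apply: (ler_wmean KP').
  - exact: (bF _ _ (path_ext t)).
  - exact: bdd_on_cst.
  - by move=> z _; rewrite (le_trans (ler_norm _)).
have bi : bdd_on (D n) (fun t => wmean [set: X] (K n (path_end t)) (fun z => F (path_ext t z))).
  by exists B => t _; have /andP[i0 iB] := inner t; rewrite ger0_norm.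
apply: EFin_inj; rewrite (ge0_wmeanE (inh_pmf _) (bF _ _ id))//.
rewrite (ge0_wmeanE (inh_pmf n0) bi); last by move=> t _; have /andP[] := inner t.
rewrite esum_path_ext//; last by move=> t; rewrite mulr_ge0// inh_weight_ge0.
apply: eq_esum => t Dt; have KP' := KP n0 (path_end t).
rewrite EFinM ge0_wmeanE//; last exact: (bF _ _ (path_ext t)).
rewrite -ge0_esumZ ?inh_weight_ge0//; last by case: KP' => k0 _ z _; rewrite mulr_ge0// k0.
by apply: eq_esum => z _; rewrite inh_weight_ext mulrA -Dt.
Qed.

(** Every statistic of the clumps fixes the current state, so the sum over the next state has a
    single term. All later recursions start here. *)
Lemma wmean_step1 n (y : X) (F : X * seq X -> R) : (0 < n)%N ->
  (exists B, forall t, `|F t| <= B) -> (forall t, 0 <= F t) ->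
  (forall t z, path_len t = n -> z != y -> F (path_ext t z) = 0) ->
  wmean (D n.+1) w F =
  wmean (D n) w (fun t => K n (path_end t) y * F (path_ext t y)).
Proof.
move=> n0 FB F0 Fy; rewrite wmean_step//; apply: eq_wmean => t Dt.
by apply: dsum_delta => // z _ zy; rewrite Fy// mulr0.
Qed.

End inhomogeneous_chain.

(** * Kernels of the form [I + G / c] *)

Definition rate_ok (R : realType) (X : countType) (G : X -> X -> R) (r : R) : Prop :=
  0 < r /\ forall i j, 0 <= @idm R X i j + G i j / r.

Lemma idm_diag (R : realType) (X : countType) (i : X) : @idm R X i i = 1.
Proof. by rewrite /idm eqxx. Qed.

Lemma idm_off (R : realType) (X : countType) (i j : X) : i != j -> @idm R X i j = 0.
Proof. by rewrite /idm => /negbTE ->. Qed.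

Section generator_kernels.
Variables (R : realType) (X : countType) (G : X -> X -> R).
Hypothesis GP : generator G.

Lemma generator_diag_le0 i : G i i <= 0.
Proof.
case: GP => [G0 Gs _]; rewrite -oppr_ge0 -lee_fin Gs esum_ge0// => j /= ji.
by rewrite lee_fin G0 // eq_sym.
Qed.

Lemma rate_ok_le r s : rate_ok G r -> r <= s -> rate_ok G s.
Proof.
move=> [r0 rG] rs; have s0 := lt_le_trans r0 rs; split => // i j.
case: GP => [G0 _ _].
have [<-|ij] := eqVneq i j; last first.
  by rewrite idm_off// add0r divr_ge0 ?G0// ltW.
have := rG i i; rewrite !idm_diag.
have g0 := generator_diag_le0 i.
have -> : 1 + G i i / r = (r + G i i) / r by field; rewrite gt_eqF.
have -> : 1 + G i i / s = (s + G i i) / s by field; rewrite gt_eqF.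
by rewrite !pmulr_lge0 ?invr_gt0//; lra.
Qed.

(** The set under the infimum is upward closed, and non-empty because the diagonal of [G] is
    bounded; hence it contains everything above its infimum. *)
Lemma rate_bound_ok r : rate_bound G < r -> rate_ok G r.
Proof.
move=> rr; have [_ _ [B GB]] := GP.
have [m m0 Bm] : exists2 m : R, 0 < m & B <= m.
  by exists (Num.max B 1); rewrite ?lt_max ?le_max ?ltr01 ?lexx ?orbT.
have : [set r : R | 0 < r /\ forall i j, 0 <= @idm R X i j + G i j / r] !=set0.
  exists m; split => // i j; have [G0 _ _] := GP.
  have [<-|ij] := eqVneq i j; last first.
    by rewrite idm_off// add0r divr_ge0 ?G0// ltW.
  have -> : @idm R X i i + G i i / m = (m + G i i) / m.
    by rewrite idm_diag; field; rewrite gt_eqF.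
  apply: divr_ge0; last exact: ltW.
  by have := GB i; rewrite ler_norml => /andP[h _]; lra.
by move=> /(inf_lt)/(_ rr)[s sP /ltW]; exact: rate_ok_le.
Qed.

Lemma rate_ok_stochastic c : rate_ok G c -> stochastic (fun i j => @idm R X i j + G i j / c).
Proof.
move=> [c0 cG] i; split=> [j _|]; first exact: cG.
rewrite (esumID [set i])/=; last by move=> j _; rewrite lee_fin.
rewrite !setTI esum_set1 ?lee_fin//.
have [G0 Gs _] := GP.
transitivity ((@idm R X i i + G i i / c)%:E + \esum_(j in [set j | j != i]) (c^-1 * G i j)%:E)%E.
  congr (_ + _)%E; rewrite (_ : ~` [set i] = [set j | j != i]); last first.
    by apply/seteqP; split => j /= /eqP.
  by apply: eq_esum => j /= ji; rewrite idm_off ?add0r 1?mulrC// eq_sym.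
rewrite ge0_esumZ ?invr_ge0 ?ltW//; last by move=> j /= ji; rewrite G0// eq_sym.
by rewrite -Gs -EFinM -EFinD idm_diag; congr (_%:E); field; rewrite gt_eqF.
Qed.

Lemma idm_stochastic : stochastic (@idm R X).
Proof.
move=> i; split=> [j _|]; first by rewrite /idm.
rewrite (esumID [set i])/=; last by move=> j _; rewrite lee_fin /idm.
rewrite !setTI esum_set1 ?lee_fin /idm ?eqxx// esum1 ?adde0// => j /= ij.
by case: eqP => // /esym.
Qed.

Lemma Kn_stochastic M n : rate_bound G < M%:R -> stochastic (Kn G M n).
Proof.
move=> rM; have [Mn|nM] := ltnP M n; last first.
  have -> : Kn G M n = @idm R X; last exact: idm_stochastic.
  by apply/funext => i; apply/funext => j; rewrite /Kn ltnNge nM mulr0 addr0.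
have -> : Kn G M n = fun i j => @idm R X i j + G i j / n%:R.
  by apply/funext => i; apply/funext => j; rewrite /Kn Mn mulr1.
apply: rate_ok_stochastic; apply: (rate_ok_le (rate_bound_ok rM)).
by rewrite ler_nat ltnW.
Qed.

End generator_kernels.

(** * Powers of a stochastic kernel *)

Section kernel_powers.
Variables (R : realType) (X : countType) (Q : X -> X -> R).
Hypothesis QP : stochastic Q.

(** The entry [Q^j x y], with the new step added at the start [x] rather than at the end as in
    [vecpow]: this makes it a bounded function of the current state, which can be averaged over
    paths. *)
Fixpoint hit_pow (y : X) (j : nat) : X -> R :=
  if j is j'.+1 then fun x => wmean [set: X] (Q x) (hit_pow y j')
  else fun x => (x == y)%:R.

Lemma hit_pow_itv y j x : 0 <= hit_pow y j x <= 1.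
Proof.
elim: j x => [|j IH] x /=; first by case: eqP; rewrite ?lexx ?ler01.
rewrite wmean_ge0//=; last by move=> z _; have /andP[] := IH z.
rewrite -[leRHS](wmean_cst (QP x)); apply: (ler_wmean (QP x)).
- by exists 1 => z _; have /andP[h0 h1] := IH z; rewrite ger0_norm.
- exact: bdd_on_cst.
- by move=> z _; have /andP[] := IH z.
Qed.

Lemma hit_pow_bdd (T : choiceType) (D : set T) y j (f : T -> X) :
  bdd_on D (fun t => hit_pow y j (f t)).
Proof. by exists 1 => t _; have /andP[h0 h1] := hit_pow_itv y j (f t); rewrite ger0_norm. Qed.

(** Tonelli: both sides equal the double sum of [v x * Q x z * h z]. *)
Lemma esum_vecmul (v h : X -> R) : pmf_on [set: X] v -> (forall x, 0 <= h x <= 1) ->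
  (\esum_(z in [set: X]) (vecmul v Q z * h z)%:E =
   \esum_(x in [set: X]) (v x * wmean [set: X] (Q x) h)%:E)%E.
Proof.
move=> vP hP; have [v0 v1] := vP.
have h0 z : 0 <= h z by have /andP[] := hP z.
have bh : bdd_on [set: X] h by exists 1 => z _; rewrite ger0_norm//; have /andP[] := hP z.
have q0 x z : 0 <= Q x z by case: (QP x) => q0 _; exact: q0.
have vq z : bdd_on [set: X] (Q^~ z).
  by exists 1 => x _; rewrite ger0_norm// (pmf_on_le1 z (QP x)).
have e1 z : ((vecmul v Q z * h z)%:E = \esum_(x in [set: X]) (v x * Q x z * h z)%:E)%E.
  rewrite mulrC EFinM (ge0_wmeanE vP (vq z))// -ge0_esumZ//.
    by apply: eq_esum => x _; rewrite mulrC.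
  by move=> x _; rewrite mulr_ge0// v0.
have e2 x : ((v x * wmean [set: X] (Q x) h)%:E = \esum_(z in [set: X]) (v x * Q x z * h z)%:E)%E.
  rewrite EFinM (ge0_wmeanE (QP x) bh)// -ge0_esumZ ?v0//.
    by apply: eq_esum => z _; rewrite mulrA.
  by move=> z _; rewrite mulr_ge0.
under eq_esum do rewrite e1.
under [RHS]eq_esum do rewrite e2.
have p0 (x z : X) : 0 <= v x * Q x z * h z by rewrite mulr_ge0// mulr_ge0// v0.
rewrite esum_esum; last by move=> *; rewrite lee_fin.
rewrite [RHS]esum_esum; last by move=> *; rewrite lee_fin.
rewrite (@reindex_esum _ _ _ ([set: X] `*`` (fun=> [set: X])) _ (fun k => (k.2, k.1)))//.
split => //=.
- by move=> [a b] [c d] _ _ /= [-> ->].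
- by move=> [a b] _; exists (b, a).
Qed.

Lemma vecmul_pmf v : pmf_on [set: X] v -> pmf_on [set: X] (vecmul v Q).
Proof.
move=> vP; have [v0 v1] := vP; split.
  move=> z _; apply: dsum_ge0 => x _; rewrite mulr_ge0 ?v0//.
  by case: (QP x) => q0 _; exact: q0.
have := esum_vecmul vP (fun=> _ : 0 <= 1 <= 1); rewrite lexx ler01 => /(_ isT) h.
transitivity (\esum_(z in [set: X]) (vecmul v Q z * 1)%:E)%E.
  by apply: eq_esum => z _; rewrite mulr1.
rewrite h -v1; apply: eq_esum => x _; rewrite (wmean_cst (QP x)) mulr1//.
Qed.

Lemma wmean_hit_pow v y j : pmf_on [set: X] v ->
  wmean [set: X] v (hit_pow y j) = vecpow v Q j y.
Proof.
elim: j v => [|j IH] v vP.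
  rewrite /wmean /vecpow /= (@dsum_delta _ _ _ y)// ?eqxx ?mulr1// => x _ /negbTE ->.
  by rewrite mulr0.
rewrite /vecpow iterSr; have := IH _ (vecmul_pmf vP); rewrite /vecpow => <-.
apply: EFin_inj; rewrite (ge0_wmeanE vP (hit_pow_bdd _ y j.+1 id)); last first.
  by move=> x _; have /andP[] := hit_pow_itv y j.+1 x.
rewrite (ge0_wmeanE (vecmul_pmf vP) (hit_pow_bdd _ y j id)); last first.
  by move=> x _; have /andP[] := hit_pow_itv y j x.
by rewrite esum_vecmul// => x; exact: hit_pow_itv.
Qed.

End kernel_powers.

(** * Marginals of the inhomogeneous chain *)

Section marginals.
Variables (R : realType) (X : countType) (G : X -> X -> R).
Variables (theta : R) (M : nat) (pi mu : X -> R).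
Hypothesis GP : generator G.
Hypothesis th0 : 0 < theta.
Hypothesis rth : rate_bound G < theta.
Hypothesis rM : rate_bound G < M%:R.
Hypothesis piP : pmf_on [set: X] pi.
Hypothesis pimu : forall j, (fun n => vecpow pi (Qmat G theta) n j) @ \oo --> mu j.

Let D n := @paths_of_len X n.
Let w := inh_weight pi (Kn G M).
Let KP v : (0 < v)%N -> stochastic (Kn G M v). Proof. by move=> _; exact: Kn_stochastic. Qed.
Let QP : stochastic (Qmat G theta).
Proof. by apply: rate_ok_stochastic => //; apply: rate_bound_ok. Qed.

Definition end_hit (y : X) (n j : nat) : R :=
  wmean (D n) w (fun t => hit_pow (Qmat G theta) y j (path_end t)).

Lemma wmean_idm x (h : X -> R) : wmean [set: X] (@idm R X x) h = h x.
Proof.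
rewrite /wmean (@dsum_delta _ _ _ x)// /idm ?eqxx ?mul1r// => z _ xz.
by rewrite eq_sym (negbTE xz) mul0r.
Qed.

Lemma end_hitS y n j : (0 < n)%N -> end_hit y n.+1 j =
  if (M < n)%N then (1 - theta / n%:R) * end_hit y n j + theta / n%:R * end_hit y n j.+1
  else end_hit y n j.
Proof.
move=> n0; rewrite {1}/end_hit.
rewrite (wmean_step piP KP n0); last 2 first.
- by exists 1 => t; have /andP[h0 h1] := hit_pow_itv QP y j (path_end t); rewrite ger0_norm.
- by move=> t; have /andP[] := hit_pow_itv QP y j (path_end t).
have wP := inh_pmf piP KP n0.
have hb i := @hit_pow_bdd _ _ _ QP _ (D n) y i (@path_end X).
have -> : (fun t => wmean [set: X] (Kn G M n (path_end t))
     (fun z => hit_pow (Qmat G theta) y j (path_end (path_ext t z)))) =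
   (fun t => wmean [set: X] (Kn G M n (path_end t)) (hit_pow (Qmat G theta) y j)).
  apply/funext => t; apply: eq_wmean => z _; by rewrite path_end_ext.
case: ifPn => Mn; last first.
  apply: eq_wmean => t _.
  rewrite -[RHS](wmean_idm (path_end t) (hit_pow (Qmat G theta) y j)).
  by apply: eq_dsum => z _; rewrite /Kn (negbTE Mn) mulr0 addr0.
rewrite -(wmeanZ wP _ (hb _)) -(wmeanZ wP _ (hb _)) -(wmeanD wP); [|exact: bdd_onZ..].
apply: eq_wmean => t _; set x := path_end t.
have nR : n%:R != 0 :> R by rewrite pnatr_eq0 -lt0n.
have hbT := @hit_pow_bdd _ _ _ QP _ [set: X] y j id.
transitivity (dsum [set: X] (fun z => (1 - theta / n%:R) * (@idm R X x z * hit_pow (Qmat G theta) y j z) +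
    theta / n%:R * (Qmat G theta x z * hit_pow (Qmat G theta) y j z))).
  apply: eq_dsum => z _; rewrite /Kn Mn /Qmat mulr1; field.
  by rewrite nR gt_eqF.
have s1 := wmean_summable (@idm_stochastic R X x) hbT.
have s2 := wmean_summable (QP x) hbT.
rewrite dsumD ?dsumZ//; [|exact: dsummableZ..].
by rewrite -/(wmean _ _ _) wmean_idm.
Qed.

Lemma end_hit_cvg y j : (fun n => end_hit y n j) @ \oo --> mu y.
Proof.
apply: (@array_cvg _ theta _ (end_hit y) M.+1) => //.
  by move=> n i Mn; rewrite end_hitS ?Mn//; case: n Mn.
(* The kernels up to time [M] are the identity, so [T_{M+1}] still has law [pi] and row [M.+1] is
   [pi Q^j], whose convergence is the hypothesis. *)
suff h n : (n <= M)%N -> end_hit y n.+1 = fun j => vecpow pi (Qmat G theta) j y.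
  by rewrite h.
elim: n => [_|n IH nM]; last first.
  by apply/funext => i; rewrite end_hitS// ltnNge nM /= IH// ltnW.
apply/funext => i; rewrite -(wmean_hit_pow QP)//.
apply: EFin_inj.
rewrite (ge0_wmeanE (inh_pmf piP KP _) (hit_pow_bdd QP _ y i (@path_end X)))//; last first.
  by move=> t _; have /andP[] := hit_pow_itv QP y i (path_end t).
rewrite (ge0_wmeanE piP (hit_pow_bdd QP _ y i id))//; last first.
  by move=> t _; have /andP[] := hit_pow_itv QP y i t.
rewrite (@esum_paths1 _ _ (fun t => inh_weight pi (Kn G M) t * hit_pow (Qmat G theta) y i (path_end t))).
by apply: eq_esum => x _; rewrite /inh_weight /path_len/= big_geq// mulr1.
Qed.

End marginals.

(** * Clumps of a path *)

Section clumps.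
Variable X : eqType.
Implicit Types (t : X * seq X) (z : X).

Lemma path_ext_ind (P : X * seq X -> Prop) : (forall x, P (x, [::])) ->
  (forall t z, P t -> P (path_ext t z)) -> forall t, P t.
Proof.
move=> P0 PS [x s]; elim/last_ind: s => // s z IH; exact: (PS (x, s)).
Qed.

Lemma Vs_ext t z :
  Vs (path_ext t z) = if z == path_end t then Vs t else rcons (Vs t) (path_len t).+1.
Proof.
have e : iota 2 (path_len t) = rcons (iota 2 (size t.2)) (path_len t).+1.
  by rewrite /path_len -(addn1 (size t.2)) iotaD cats1 addn1.
rewrite /Vs path_len_ext e filter_rcons pT_ext_len pT_ext// pT_len.
have -> : [seq v <- iota 2 (size t.2) | pT (path_ext t z) v != pT (path_ext t z) v.-1] =
    [seq v <- iota 2 (size t.2) | pT t v != pT t v.-1].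
  apply: eq_in_filter => v; rewrite mem_iota => /andP[v2 vs].
  by rewrite !pT_ext// /path_len; move: vs v2; lia.
by case: eqP.
Qed.

Lemma Vs_bounds t v : v \in Vs t -> (0 < v <= path_len t)%N.
Proof.
rewrite /Vs inE mem_filter mem_iota /path_len /= => /orP[/eqP->//|/andP[_]]; lia.
Qed.

(* The number b_k of times preceding the k last clumps; it is 0 as soon as
   the path has at most k clumps. *)
Definition clump_end t k : nat := (nth 1 ((path_len t).+1 :: rev (Vs t)) k).-1%N.

Lemma clump_end0 t : clump_end t 0 = path_len t. Proof. by []. Qed.

Lemma clump_end_ext t z k : clump_end (path_ext t z) k.+1 =
  if z == path_end t then clump_end t k.+1 else clump_end t k.
Proof. by rewrite /clump_end /= Vs_ext; case: eqP => // _; rewrite rev_rcons. Qed.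

Lemma clump_end_le t k : (clump_end t k.+1 <= clump_end t k)%N.
Proof.
elim/path_ext_ind: t k => [x|t z IH] k; first by case: k => [|k]; rewrite /clump_end /= ?nth_nil.
case: k => [|k]; rewrite !clump_end_ext; case: eqP => // _.
- by rewrite clump_end0 path_len_ext; apply: leq_trans (IH 0) _; rewrite clump_end0.
- by rewrite !clump_end0 path_len_ext.
Qed.

Lemma size_Vs t : (0 < size (Vs t))%N. Proof. by []. Qed.

Lemma nth_rev_Vs t k : (k < size (Vs t))%N ->
  nth 1%N (rev (Vs t)) k = nth 0%N (Vs t) (size (Vs t) - k.+1).
Proof. by move=> ks; rewrite nth_rev//; apply: set_nth_default; lia. Qed.

(** The oldest clump starts at [V_1 = 1], which is also the default value of [nth]. Indices at the
    oldest clump and beyond it are thus treated alike, in accordance with [tau = 0] and [Y = T_1]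
    from [N_n] on. *)
Lemma nth_rev_Vs_last t k : ((size (Vs t)).-1 <= k)%N -> nth 1%N (rev (Vs t)) k = 1%N.
Proof.
move=> sk; have [ks|ks] := ltnP k (size (Vs t)); last by rewrite nth_default ?size_rev.
by rewrite nth_rev_Vs// (_ : (_ - _)%N = 0%N)//; lia.
Qed.

Lemma nth_rev_Vs_gt0 t k : (0 < nth 1%N (rev (Vs t)) k)%N.
Proof.
have [ks|ks] := ltnP k (size (rev (Vs t))); last by rewrite nth_default.
by have := mem_nth 1%N ks; rewrite mem_rev => /Vs_bounds /andP[].
Qed.

Lemma tauE t k : tau t k.+1 = (clump_end t k - clump_end t k.+1)%N.
Proof.
rewrite /tau /Nn /clump_end /Vi.
move: (@nth_rev_Vs_last t) (@nth_rev_Vs t) (size_Vs t) (@nth_rev_Vs_gt0 t).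
move: (Vs t) => V L E S0 g.
case: ltnP; rewrite ?ltnS => sk.
  by case: k sk => [|k] sk /=; [move: sk S0; lia | rewrite !L//; move: sk; lia].
case: k sk => [|k] sk /=.
  by move: (g 0%N); rewrite E// subn1; set v := nth _ _ _ => v0; move: v0; lia.
rewrite (_ : ((size V).+1 - k.+1).-1 = size V - k.+1)%N; last by lia.
rewrite (_ : ((size V).+1 - k.+2).-1 = size V - k.+2)%N; last by lia.
by rewrite -!E//; [have := g k; have := g k.+1; lia | lia].
Qed.

Lemma pT_last_Vs t : pT t (nth 1%N (rev (Vs t)) 0) = path_end t.
Proof.
elim/path_ext_ind: t => [x|t z IH] //.
rewrite path_end_ext Vs_ext; case: eqP => [->|_]; last by rewrite rev_rcons pT_ext_len.
rewrite pT_ext//; have : (0 < size (rev (Vs t)))%N by rewrite size_rev.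
by move=> /(mem_nth 1%N); rewrite mem_rev => /Vs_bounds /andP[].
Qed.

Lemma YcE t k : Yc t k.+1 = pT t (nth 1%N (rev (Vs t)) k).
Proof.
rewrite /Yc /Nn /Vi.
move: (@nth_rev_Vs_last t) (@nth_rev_Vs t) (size_Vs t) (pT_last_Vs t).
move: (Vs t) => V L E S0 l.
case: ltnP; rewrite ?ltnS => sk; first by rewrite L//; move: sk; lia.
case: k sk => [|k] sk /=; first by rewrite l pT_len.
by rewrite E//; congr (pT t (nth _ _ _)); lia.
Qed.

Lemma Yc_ext_same t z k : z = path_end t -> Yc (path_ext t z) k.+1 = Yc t k.+1.
Proof.
move=> zt; rewrite !YcE Vs_ext zt eqxx pT_ext//.
have [ks|ks] := ltnP k (size (rev (Vs t))); last by rewrite nth_default.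
by have := mem_nth 1%N ks; rewrite mem_rev => /Vs_bounds /andP[].
Qed.

Lemma Yc_ext_diff t z k : z != path_end t -> Yc (path_ext t z) k.+2 = Yc t k.+1.
Proof.
move=> /negbTE zt; rewrite !YcE Vs_ext zt rev_rcons /= pT_ext//.
have [ks|ks] := ltnP k (size (rev (Vs t))); last by rewrite nth_default.
by have := mem_nth 1%N ks; rewrite mem_rev => /Vs_bounds /andP[].
Qed.

Lemma Yc1 t : Yc t 1 = path_end t. Proof. by rewrite YcE pT_last_Vs. Qed.

Definition Yseq k t : seq X := mkseq (fun j => Yc t j.+1) k.

Arguments Yseq : simpl never.

Lemma Yseq_ext k t z : Yseq k.+1 (path_ext t z) =
  if z == path_end t then Yseq k.+1 t else z :: Yseq k t.
Proof.
rewrite /Yseq; case: eqP => [zt|/eqP zt].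
  by apply: eq_map => j; rewrite Yc_ext_same.
rewrite /mkseq /= Yc1 path_end_ext; congr cons.
rewrite (iotaDl 1 0) -map_comp; apply: eq_map => j /=.
by rewrite add1n Yc_ext_diff.
Qed.

Lemma Yseq_cons k t : Yseq k.+1 t = path_end t :: behead (Yseq k.+1 t).
Proof. by rewrite /Yseq /mkseq /= Yc1. Qed.

End clumps.

(** * Clump ratios and stick breaking *)

Section clump_ratios.
Variables (R : realType) (X : eqType).
Implicit Types (t : X * seq X) (z : X).

(** Beyond the oldest clump this is 0 / 0 = 0. The value is harmless, the product of the earlier
    ratios being 0 already. *)
Definition clump_ratio t k : R := (clump_end t k.+1)%:R / (clump_end t k)%:R.

Definition Wseq k t : seq R := mkseq (clump_ratio t) k.

Arguments Wseq : simpl never.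

Lemma clump_ratio_itv t k : 0 <= clump_ratio t k <= 1.
Proof.
rewrite divr_ge0//= /clump_ratio; have [->|b0] := posnP (clump_end t k); first by rewrite invr0 mulr0.
by rewrite ler_pdivrMr ?ltr0n// mul1r ler_nat clump_end_le.
Qed.

Lemma Wseq_ext k t z : Wseq k.+1 (path_ext t z) =
  if z == path_end t then
    ((path_len t)%:R / (path_len t).+1%:R * head 0 (Wseq k.+1 t)) :: behead (Wseq k.+1 t)
  else (path_len t)%:R / (path_len t).+1%:R :: Wseq k t.
Proof.
rewrite /Wseq /mkseq /=.
have e0 : clump_ratio (path_ext t z) 0 = if z == path_end t then
    (path_len t)%:R / (path_len t).+1%:R * clump_ratio t 0 else (path_len t)%:R / (path_len t).+1%:R.
  rewrite /clump_ratio clump_end_ext !clump_end0 path_len_ext; case: eqP => // _.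
  have : (path_len t)%:R != 0 :> R by rewrite pnatr_eq0.
  have : (path_len t).+1%:R != 0 :> R by rewrite pnatr_eq0.
  by rewrite -natr1 => h1 h2; field; rewrite h1 h2.
rewrite e0; case: eqP => [zt|/eqP zt]; congr cons.
  rewrite (iotaDl 1 0) -!map_comp; apply: eq_map => j /=.
  by rewrite add1n /clump_ratio !clump_end_ext zt eqxx.
rewrite (iotaDl 1 0) -!map_comp; apply: eq_map => j /=.
by rewrite add1n /clump_ratio !clump_end_ext (negbTE zt).
Qed.

(* Residual allocation with W_j = 1 - X_j: P_j = rem * W_1 ... W_{j-1} * (1 - W_j). *)
Fixpoint stick (rem : R) (s : seq R) : seq R :=
  if s is w :: s' then rem * (1 - w) :: stick (rem * w) s' else [::].

Lemma size_stick rem s : size (stick rem s) = size s.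
Proof. by elim: s rem => //= w s IH rem; rewrite IH. Qed.

Lemma Pc_stick k t : [seq Pc R t j.+1 | j <- iota 0 k] = stick 1 (Wseq k t).
Proof.
(* Generalisation for the induction: after [i] clumps the remaining stick is [b_i / n], and the
   initial 1 is the case [i = 0]. *)
have -> : 1 = (clump_end t 0)%:R / (path_len t)%:R :> R.
  by rewrite clump_end0 divff// pnatr_eq0.
rewrite /Wseq /mkseq; elim: k 0%N => //= k IH i.
have e1 : (clump_end t i)%:R / (path_len t)%:R * clump_ratio t i =
    (clump_end t i.+1)%:R / (path_len t)%:R.
  rewrite /clump_ratio; have [b0|b0] := posnP (clump_end t i).
    by have := clump_end_le t i; rewrite b0 leqn0 => /eqP ->; rewrite !mul0r.
  field; rewrite ?pnatr_eq0 -?lt0n b0 //.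
rewrite mulrBr mulr1 e1 -IH; congr cons.
by rewrite /Pc tauE natrB ?clump_end_le// mulrBl.
Qed.

End clump_ratios.

(** * Reversed generator and limits of moments *)

Section reversed_generator.
Variables (R : realType) (X : countType) (G : X -> X -> R) (theta : R) (mu : X -> R).
Hypothesis GP : generator G.
Hypothesis G0 : forall i, G i i != 0.
Hypothesis thP : rate_ok G theta.
Hypothesis muP : pmf_on [set: X] mu.
Hypothesis muQ : forall j, vecmul mu (Qmat G theta) j = mu j.

Let mu0 i : 0 <= mu i. Proof. by case: muP => h _; exact: h. Qed.
Let off0 i j : i != j -> 0 <= G i j. Proof. by case: GP => h _ _; exact: h. Qed.
Let th0 : 0 < theta. Proof. by case: thP. Qed.

Lemma generator_diag_lt0 i : G i i < 0.
Proof. by rewrite lt_neqAle G0 generator_diag_le0. Qed.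

(** This is [mu Q = mu] with the diagonal term split off and multiplied by [theta]: inflow and
    outflow at [i] agree. It makes the rows of [Grev G mu] sum to zero. *)
Lemma stationary_esum i :
  (\esum_(j in [set j | j != i]) (mu j * G j i)%:E = (- (mu i * G i i))%:E)%E.
Proof.
have q0 x z : 0 <= Qmat G theta x z by case: thP => _; apply.
have vq : bdd_on [set: X] ((Qmat G theta)^~ i).
  by exists 1 => x _; rewrite ger0_norm// (pmf_on_le1 i (rate_ok_stochastic GP thP x)).
have := ge0_wmeanE muP vq (fun t _ => q0 t i).
rewrite /wmean -[dsum _ _]/(vecmul mu (Qmat G theta) i) muQ.
rewrite (esumID [set i])/=; last by move=> *; rewrite lee_fin mulr_ge0.
rewrite !setTI esum_set1 ?lee_fin ?mulr_ge0// (_ : ~` [set i] = [set j | j != i]); last first.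
  by apply/seteqP; split => j /= /eqP.
rewrite (_ : \esum_(j in _) _ = \esum_(j in [set j | j != i]) (theta^-1 * (mu j * G j i))%:E)%E; last first.
  by apply: eq_esum => j /= ji; rewrite /Qmat idm_off// add0r mulrC mulrAC mulrA; congr (_%:E); ring.
rewrite ge0_esumZ ?invr_ge0 ?ltW//; last by move=> j /= ji; rewrite mulr_ge0// off0.
have : (\esum_(j in [set j | j != i]) (mu j * G j i)%:E >= 0)%E.
  by apply: esum_ge0 => j /= ji; rewrite lee_fin mulr_ge0// off0.
case: (esum _ _) => [r|//|//]; last by rewrite mulry gtr0_sg ?invr_gt0// mul1e.
move=> _; rewrite -EFinM -EFinD => -[h]; congr (_%:E).
have t0 : theta != 0 by rewrite gt_eqF.
move: h; rewrite /Qmat idm_diag => h.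
have {h} : theta * mu i = theta * (mu i * (1 + G i i / theta) + theta^-1 * r) by rewrite -h.
have -> : theta * (mu i * (1 + G i i / theta) + theta^-1 * r) = theta * mu i + mu i * G i i + r by field.
lra.
Qed.

Lemma Grev_generator : generator (Grev G mu).
Proof.
split.
- move=> i j ij; rewrite /Grev mulr_ge0// mulr_ge0//; first by rewrite divr_ge0.
  by rewrite off0// eq_sym.
- move=> i; rewrite /Grev; have [mi|mi] := eqVneq (mu i) 0.
    by rewrite mulr0 oppr0 esum1// => j _; rewrite mulr0.
  rewrite mulr1 divff// mul1r.
  rewrite (_ : \esum_(j in _) _ = \esum_(j in [set j | j != i]) ((mu i)^-1 * (mu j * G j i))%:E)%E; last first.
    by apply: eq_esum => j _; congr (_%:E); rewrite mulr1; ring.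
  rewrite ge0_esumZ ?invr_ge0//; last by move=> j /= ji; rewrite mulr_ge0// off0.
  by rewrite stationary_esum -EFinM; congr (_%:E); field.
- have [_ _ [B GB]] := GP; exists B => i; rewrite /Grev.
  have [mi|mi] := eqVneq (mu i) 0; last by rewrite mulr1 divff// mul1r.
  by rewrite mulr0 normr0; exact: le_trans (GB i).
Qed.

Lemma Grev_diag i : mu i != 0 -> Grev G mu i i = G i i.
Proof. by move=> mi; rewrite /Grev mi mulr1 divff// mul1r. Qed.

(** The total inflow into a state of mass 0 vanishes, hence so does each of its nonnegative
    terms. *)
Lemma stationary_flow0 a b : a != b -> mu a = 0 -> mu b * G b a = 0.
Proof.
move=> ab ma; have := stationary_esum a; rewrite ma mul0r oppr0 => h.
apply/eqP; rewrite eq_le; apply/andP; split; last by rewrite mulr_ge0// off0// eq_sym.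
rewrite -lee_fin -h; apply: esum_ge; exists [set b].
  by split => // x /= ->; rewrite eq_sym.
by rewrite fsbig_set1.
Qed.

(** [G a a] may replace [Grev G mu a a]: they coincide when [mu a != 0], and otherwise both sides
    are 0, the right one by [stationary_flow0]. *)
Lemma detailed_balance a b :
  mu a * KG (Grev G mu) a b * - G a a = (a != b)%:R * (mu b * G b a).
Proof.
have [ma|ma] := eqVneq (mu a) 0.
  rewrite ma !mul0r; have [->|ab] := eqVneq a b; first by rewrite mul0r.
  by rewrite stationary_flow0// mulr0.
rewrite /KG Grev_diag// (negbTE (G0 a)) andbT andbF; case: eqVneq => [->|ab] /=; first by rewrite mulr0 !mul0r.
rewrite /Grev ma mulr1 mul1r; field.
by rewrite ma G0.
Qed.

Fixpoint chain_weight (K : X -> X -> R) (y : X) (ys : seq X) : R :=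
  if ys is y' :: ys' then K y y' * chain_weight K y' ys' else 1.

Definition path_weight (K : X -> X -> R) (ys : seq X) : R :=
  if ys is y :: ys' then mu y * chain_weight K y ys' else 1.

(** The recursion yields a limit with numerator [G y2 y] times the weight of the tail. This identity
    trades it for [th = - G y y] times the weight of the whole path, so that the factor
    [th / (th + m)] appears. *)
Lemma path_weight_cons2 y y2 ys :
  path_weight (KG (Grev G mu)) [:: y, y2 & ys] * - G y y =
  (y != y2)%:R * G y2 y * path_weight (KG (Grev G mu)) (y2 :: ys).
Proof.
rewrite /= mulrA mulrAC detailed_balance; ring.
Qed.

Lemma KG_ge0 (H : X -> X -> R) : generator H -> forall a b, 0 <= KG H a b.
Proof.
move=> HP a b; rewrite /KG; case: ifP => [/andP[ab _]|_]; last by case: ifP.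
have [h0 _ _] := HP; rewrite divr_ge0 ?h0// oppr_ge0.
exact: generator_diag_le0.
Qed.

Lemma KG_stochastic (H : X -> X -> R) : generator H -> stochastic (KG H).
Proof.
move=> HP a; split=> [b _|]; first exact: KG_ge0.
have [h0 hs _] := HP.
rewrite (esumID [set a])/=; last by move=> b _; rewrite lee_fin KG_ge0.
rewrite !setTI esum_set1 ?lee_fin ?KG_ge0// (_ : ~` [set a] = [set j | j != a]); last first.
  by apply/seteqP; split => j /= /eqP.
have [Ha|Ha] := eqVneq (H a a) 0.
  rewrite esum1 ?adde0; first by rewrite /KG eqxx Ha eqxx.
  by move=> b /= ba; rewrite /KG Ha eqxx andbF andbT eq_sym (negbTE ba).
rewrite (_ : \esum_(j in _) _ = \esum_(j in [set j | j != a]) ((- H a a)^-1 * H a j)%:E)%E; last first.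
  by apply: eq_esum => b /= ba; rewrite /KG eq_sym ba Ha /= mulrC.
have h1 : 0 <= - H a a by rewrite oppr_ge0; exact: generator_diag_le0.
rewrite ge0_esumZ ?invr_ge0//; last by move=> b /= ba; rewrite h0// eq_sym.
by rewrite -hs -EFinM mulVf ?oppr_eq0// /KG eqxx /= (negbTE Ha) add0e.
Qed.

Lemma chain_weight_ge0 (K : X -> X -> R) y ys : (forall a b, 0 <= K a b) -> 0 <= chain_weight K y ys.
Proof. by move=> K0; elim: ys y => //= z ys IH y; rewrite mulr_ge0. Qed.

Lemma path_weight_ge0 ys : 0 <= path_weight (KG (Grev G mu)) ys.
Proof.
case: ys => //= y ys; rewrite mulr_ge0// chain_weight_ge0//.
by apply: KG_ge0; exact: Grev_generator.
Qed.

End reversed_generator.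

(** * Monomials in the clump ratios *)

Section monomials.
Variable R : realType.

Fixpoint mono (ms : seq nat) (s : seq R) : R :=
  if ms is m :: ms' then head 0 s ^+ m * mono ms' (behead s) else 1.

Lemma mono_cons m ms s : mono (m :: ms) s = head 0 s ^+ m * mono ms (behead s).
Proof. by []. Qed.

Definition unit_seq (s : seq R) : Prop := all (fun x => 0 <= x <= 1) s.

Lemma mono_itv ms s : unit_seq s -> 0 <= mono ms s <= 1.
Proof.
elim: ms s => [|m ms IH] s /= us; first by rewrite ler01 lexx.
have h0 : 0 <= head 0 s <= 1 by case: s us => [|x s] /=; rewrite ?lexx ?ler01// => /andP[].
have us' : unit_seq (behead s) by case: s us {h0} => //= x s /andP[].
have /andP[a0 a1] := IH _ us'; have /andP[b0 b1] := h0.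
by rewrite mulr_ge0 ?exprn_ge0//= mulr_ile1 ?exprn_ge0// exprn_ile1.
Qed.

(** The mixed moment of independent [1 - X_j] with [X_j] of law Beta(1, th_j), as the [m]-th moment
    of one such variable is [th / (th + m)]. *)
Definition moment_factor (ths : seq R) (ms : seq nat) : R :=
  \prod_(p <- zip ths ms) (p.1 / (p.1 + p.2%:R)).

Lemma moment_factor_cons th ths m ms :
  moment_factor (th :: ths) (m :: ms) = th / (th + m%:R) * moment_factor ths ms.
Proof. by rewrite /moment_factor /= big_cons. Qed.

End monomials.

(** * Limits of the clump moments *)

Section moment_limits.
Variables (R : realType) (X : countType) (G : X -> X -> R).
Variables (theta : R) (M : nat) (pi mu : X -> R).
Hypothesis GP : generator G.
Hypothesis G0 : forall i, G i i != 0.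
Hypothesis th0 : 0 < theta.
Hypothesis rth : rate_bound G < theta.
Hypothesis rM : rate_bound G < M%:R.
Hypothesis piP : pmf_on [set: X] pi.
Hypothesis muP : pmf_on [set: X] mu.
Hypothesis muQ : forall j, vecmul mu (Qmat G theta) j = mu j.
Hypothesis pimu : forall j, (fun n => vecpow pi (Qmat G theta) n j) @ \oo --> mu j.

Let D n := @paths_of_len X n.
Let w := inh_weight pi (Kn G M).
Let KP v : (0 < v)%N -> stochastic (Kn G M v). Proof. by move=> _; exact: Kn_stochastic. Qed.
Let thP : rate_ok G theta. Proof. exact: rate_bound_ok. Qed.

Definition clump_stat (ys : seq X) (ms : seq nat) (t : X * seq X) : R :=
  (Yseq (size ys) t == ys)%:R * mono ms (Wseq R (size ys) t).

Lemma Wseq_unit k (t : X * seq X) : unit_seq (Wseq R k t).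
Proof. by apply/allP => x /mapP[j _ ->]; exact: clump_ratio_itv. Qed.

Lemma clump_stat_nil t : clump_stat [::] [::] t = 1.
Proof. by rewrite /clump_stat /= mulr1. Qed.

Lemma clump_stat_itv ys ms t : 0 <= clump_stat ys ms t <= 1.
Proof.
have /andP[a b] := mono_itv ms (Wseq_unit (size ys) t).
by rewrite /clump_stat; case: eqP => _; rewrite ?mul1r ?a ?b ?mul0r ?lexx ?ler01.
Qed.

Lemma clump_stat_ext y ys m ms t :
  clump_stat (y :: ys) (m :: ms) (path_ext t y) =
  ((path_len t)%:R / (path_len t).+1%:R) ^+ m *
  (if y == path_end t then clump_stat (y :: ys) (m :: ms) t else clump_stat ys ms t).
Proof.
rewrite /clump_stat [size (y :: ys)]/= Yseq_ext Wseq_ext; have [ye|ye] := eqVneq y (path_end t).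
  by rewrite !mono_cons [head _ (_ :: _)]/= [behead (_ :: _)]/= exprMn -mulrA mulrCA.
by rewrite eqseq_cons eqxx mono_cons [head _ (_ :: _)]/= [behead (_ :: _)]/= mulrCA.
Qed.

Lemma clump_stat_ext0 y ys m ms t z : z != y ->
  clump_stat (y :: ys) (m :: ms) (path_ext t z) = 0.
Proof.
move=> zy; rewrite /clump_stat Yseq_cons path_end_ext eqseq_cons (negbTE zy) /=.
by rewrite mul0r.
Qed.

Lemma clump_stat_end y ys ms t : path_end t != y -> clump_stat (y :: ys) ms t = 0.
Proof. by move=> ty; rewrite /clump_stat Yseq_cons eqseq_cons (negbTE ty) mul0r. Qed.

Lemma clump_stat_bdd E ys ms : bdd_on E (clump_stat ys ms).
Proof. by exists 1 => t _; have /andP[a b] := clump_stat_itv ys ms t; rewrite ger0_norm. Qed.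

Lemma moment_step y ys m ms n : (0 < n)%N ->
  wmean (D n.+1) w (clump_stat (y :: ys) (m :: ms)) =
  (n%:R / n.+1%:R) ^+ m * (Kn G M n y y * wmean (D n) w (clump_stat (y :: ys) (m :: ms)) +
    wmean (D n) w (fun t => (path_end t != y)%:R * Kn G M n (path_end t) y * clump_stat ys ms t)).
Proof.
move=> n0; have wP := inh_pmf piP KP n0.
have Kb : bdd_on (D n) (fun t => (path_end t != y)%:R * Kn G M n (path_end t) y * clump_stat ys ms t).
  apply: bdd_onM; last exact: clump_stat_bdd.
  exists 1 => t _; have [k0 k1] := KP n0 (path_end t).
  rewrite normrM (ger0_norm (k0 _ _))//; case: (_ == _) => /=; rewrite ?normr0 ?normr1 ?mul0r ?mul1r//.
  exact: pmf_on_le1 (KP n0 _).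
rewrite (wmean_step1 piP KP (y := y) n0); first last.
- by move=> t z _ zy; exact: clump_stat_ext0.
- by move=> t; have /andP[] := clump_stat_itv (y :: ys) (m :: ms) t.
- by exists 1 => t; have /andP[a b] := clump_stat_itv (y :: ys) (m :: ms) t; rewrite ger0_norm.
have cb := clump_stat_bdd (D n) (y :: ys) (m :: ms).
have cKb := bdd_onZ (Kn G M n y y) cb.
rewrite -(wmeanZ wP _ cb) -(wmeanD wP cKb Kb) -(wmeanZ wP _ (bdd_onD cKb Kb)).
apply: eq_wmean => t Dt; rewrite clump_stat_ext Dt eq_sym.
have [<-|ty] := eqVneq (path_end t) y; first by rewrite /=; ring.
by rewrite clump_stat_end//=; ring.
Qed.

Lemma moment_cvg ys ms : size ms = size ys ->
  (fun n => wmean (D n) w (clump_stat ys ms)) @ \oo -->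
    path_weight mu (KG (Grev G mu)) ys * moment_factor [seq - G y y | y <- ys] ms.
Proof.
have gpos y : 0 < - G y y by rewrite oppr_gt0 generator_diag_lt0.
elim: ys ms => [|y ys IH] [|m ms]//= => [_|[sz]].
  rewrite /moment_factor big_nil mulr1.
  apply: (cvg_trans _ (@cvg_cst R 1 nat \oo _)); apply: near_eq_cvg.
  near=> n; have n0 : (0 < n)%N by near: n; exists 1%N.
  have <- := wmean_cst (inh_pmf piP KP n0) 1.
  by apply: eq_wmean => t _; rewrite clump_stat_nil.
have := IH _ sz; case: ys sz {IH} => [|y2 ys] sz IH.
  case: ms sz {IH} => // _.
  have -> : path_weight mu (KG (Grev G mu)) [:: y] * moment_factor [:: - G y y] [:: m] =
      (mu y * - G y y) / (- G y y + m%:R).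
    rewrite /= /moment_factor big_seq1 /=; ring.
  (* A single clump: the mass entering [y] at time [n] is P(T_{n+1} = y) minus the mass that was at
     [y] and stayed. By [end_hitS] the former is a combination of [A n 0] and [A n 1]; both tend to
     [mu y], so [n] times the inflow tends to [mu y * - G y y]. *)
  pose A := end_hit G theta M pi y.
  have A0 : A ^~ 0%N @ \oo --> mu y by exact: end_hit_cvg.
  have A1 : A ^~ 1%N @ \oo --> mu y by exact: end_hit_cvg.
  apply: (@recursion_cvg _ _ _ _ _
    (fun n => theta * (A n 1%N - A n 0%N) + A n 0%N * - G y y)) => //; last first.
    rewrite -[X in _ --> X]add0r -[X in _ --> X + _](mulr0 theta) -[X in _ * X + _](subrr (mu y)).
    apply: cvgD; apply: cvgM => //; last exact: cvg_cst; first exact: cvg_cst.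
    exact: cvgB.
  near=> n.
  have n0 : (0 < n)%N by near: n; exists 1%N.
  have Mn : (M < n)%N by near: n; exists M.+1.
  have nR : n%:R != 0 :> R by rewrite pnatr_eq0 -lt0n.
  rewrite moment_step//; congr (_ * (_ + _)); first by rewrite /Kn Mn mulr1 idm_diag mulNr opprK.
  have wP := inh_pmf piP KP n0.
  have -> : theta * (A n 1%N - A n 0%N) + A n 0%N * - G y y =
     n%:R * (((1 - theta / n%:R) * A n 0%N + theta / n%:R * A n 1%N) - (1 + G y y / n%:R) * A n 0%N).
    by field.
  rewrite mulrC mulKf//.
  have := end_hitS GP th0 rth rM piP y 0 n0; rewrite Mn => <-.
  rewrite {1}/end_hit (wmean_step1 piP KP (y := y) n0); first last.
  - by move=> t z _ zy; rewrite /= path_end_ext (negbTE zy).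
  - by move=> t /=.
  - by exists 1 => t /=; case: eqP; rewrite ?normr0 ?normr1.
  have hb : bdd_on (D n) (fun t => (path_end t == y)%:R : R).
    by exists 1 => t _; case: eqP; rewrite ?normr0 ?normr1.
  have kb : bdd_on (D n) (fun t => Kn G M n (path_end t) y * (path_end (path_ext t y) == y)%:R).
    exists 1 => t _; have [k0 k1] := KP n0 (path_end t).
    rewrite path_end_ext eqxx mulr1 (ger0_norm (k0 _ _))//.
    exact: pmf_on_le1 (KP n0 _).
  rewrite -(wmeanZ wP _ hb) -(wmeanB wP kb (bdd_onZ _ hb)).
  apply: eq_wmean => t _; rewrite path_end_ext eqxx clump_stat_nil.
  have [->|ty] := eqVneq (path_end t) y; last by rewrite /=; ring.
  by rewrite /Kn Mn mulr1 idm_diag /=; ring.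
have -> : path_weight mu (KG (Grev G mu)) [:: y, y2 & ys] *
      moment_factor [seq - G y y | y <- [:: y, y2 & ys]] (m :: ms) =
    (y != y2)%:R * G y2 y * (path_weight mu (KG (Grev G mu)) (y2 :: ys) *
      moment_factor [seq - G y y | y <- y2 :: ys] ms) /
      (- G y y + m%:R).
  rewrite [map _ (y :: _)]/= moment_factor_cons.
  have := path_weight_cons2 GP G0 thP muP muQ y y2 ys.
  move: (path_weight _ _ (y :: _)) (path_weight _ _ (y2 :: _)) (moment_factor _ _)
    ((y != y2)%:R : R) => a b c k abE.
  by transitivity (a * - G y y * c / (- G y y + m%:R)); [ring | rewrite abE; ring].
apply: (@recursion_cvg _ _ _ _ _
  (fun n => (y != y2)%:R * G y2 y * wmean (D n) w (clump_stat (y2 :: ys) ms))) => //; last first.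
  by apply: cvgM => //; exact: cvg_cst.
near=> n.
have n0 : (0 < n)%N by near: n; exists 1%N.
have Mn : (M < n)%N by near: n; exists M.+1.
rewrite moment_step//; congr (_ * (_ + _)); first by rewrite /Kn Mn mulr1 idm_diag mulNr opprK.
have wP := inh_pmf piP KP n0.
rewrite mulrAC -(wmeanZ wP); last exact: clump_stat_bdd.
(* With two or more clumps the statistic of the older ones forces the old end to be [y2], so one
   entry of the kernel survives and the induction hypothesis gives the limit of the source. *)
apply: eq_wmean => t _; have [->|ty] := eqVneq (path_end t) y2; last first.
  by rewrite clump_stat_end// !mulr0.
have [->|yy] := eqVneq y2 y; first by rewrite !mul0r.
by rewrite /Kn Mn mulr1 idm_off//=; ring.
Unshelve. all: by end_near. Qed.

End moment_limits.

(** * The Beta(1, th) distribution *)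

Section beta_density.
Variable R : realType.
Notation lam := (@lebesgue_measure R).

Lemma measurable_onem_powR (p : R) (E : set R) : measurable_fun E (fun x : R => (1 - x) `^ p).
Proof.
apply: (@measurable_funTS _ _ _ _ E).
apply: (measurableT_comp (measurable_powR p)); exact: measurable_funB.
Qed.

Lemma is_derive_onem_powR (a x : R) : 0 < a -> x < 1 ->
  is_derive x 1 (fun y : R => - a^-1 * (1 - y) `^ a) ((1 - x) `^ (a - 1)).
Proof.
move=> a0 x1.
have h1 : is_derive x 1 (fun y : R => 1 - y) (-1).
  by apply: is_derive_eq; rewrite add0r mul1r.
have x10 : 0 < 1 - x by rewrite subr_gt0.
have h2 := @is_derive1_comp R (fun z => z `^ a) (fun y => 1 - y) x _ _ (is_derive1_powR a x10) h1.
have -> : (fun y : R => - a^-1 * (1 - y) `^ a) = (- a^-1) \*: ((fun z => z `^ a) \o (fun y => 1 - y)).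
  by apply/funext.
apply: is_derive_eq; rewrite /GRing.scale /=; field.
by rewrite gt_eqF.
Qed.

(** For [a < 1] the integrand blows up at 1. The fundamental theorem is therefore used only up to
    [c < 1], and the endpoint is reached by monotone convergence. *)
Lemma integral_onem_powR_itv (a c : R) : 0 < a -> 0 < c < 1 ->
  (\int[lam]_(x in `[0%R, (c)%R]) ((1 - x) `^ (a - 1))%:E = (a^-1 - a^-1 * (1 - c) `^ a)%:E)%E.
Proof.
move=> a0 /andP[c0 c1].
have der (p x : R) : 0 < p -> x < 1 -> derivable (fun y : R => - p^-1 * (1 - y) `^ p) x 1.
  by move=> p0 x1; have [] := is_derive_onem_powR p0 x1.
have cont (p x : R) : x < 1 -> {for x, continuous (fun y : R => (1 - y) `^ p)}.
  move=> x1; apply: differentiable_continuous; apply/derivable1_diffP.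
  have x10 : 0 < 1 - x by rewrite subr_gt0.
  have h1 : is_derive x 1 (fun y : R => 1 - y) (-1).
    by apply: is_derive_eq; rewrite add0r mul1r.
  by have [] := @is_derive1_comp R (fun z => z `^ p) (fun y => 1 - y) x _ _ (is_derive1_powR p x10) h1.
have contF x : x < 1 -> {for x, continuous (fun y : R => - a^-1 * (1 - y) `^ a)}.
  by move=> x1; apply: differentiable_continuous; apply/derivable1_diffP; exact: der.
rewrite (@continuous_FTC2 _ _ (fun y : R => - a^-1 * (1 - y) `^ a))//.
- rewrite subr0 powR1 mulr1 -EFinB; congr (_%:E); ring.
- apply: continuous_in_subspaceT => x; rewrite inE/= in_itv/= => /andP[_ xc].
  by apply: cont; exact: le_lt_trans c1.
- split.
  + move=> x; rewrite in_itv/= => /andP[_ xc]; apply: der => //; exact: lt_trans c1.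
  + by apply: cvg_at_right_filter; apply: contF.
  + by apply: cvg_at_left_filter; apply: contF.
- move=> x; rewrite in_itv/= => /andP[_ xc]; rewrite derive1E.
  by have [_ ->] := is_derive_onem_powR a0 (lt_trans xc c1).
Qed.

Lemma bigcup_itv_onem_harmonic :
  \bigcup_n `[0, 1 - harmonic n.+1]%classic = `[0, 1[%classic :> set R.
Proof.
apply/seteqP; split => x.
  move=> [n _] /=; rewrite !in_itv/= => /andP[-> xn] /=.
  by apply: (le_lt_trans xn); rewrite ltrBlDr ltrDl harmonic_gt0.
rewrite /= in_itv/= => /andP[x0 x1].
have x10 : 0 < 1 - x by rewrite subr_gt0.
have [n _ /(_ n (leqnn _))] : \forall n \near \oo, (harmonic n.+1 : R) < 1 - x.
  have : (fun n => harmonic n.+1 : R) @ \oo --> 0.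
    by rewrite (cvg_shiftS (@harmonic R)); exact: cvg_harmonic.
  by move=> /cvgr0_norm_lt/(_ _ x10); apply: filterS => n; rewrite ger0_norm// harmonic_ge0.
by move=> /= hn; exists n => //=; rewrite in_itv/= x0 /= lerBrDr addrC -lerBrDr ltW.
Qed.

Lemma integral_onem_powR (a : R) : 0 < a ->
  (\int[lam]_(x in `[0%R, (1)%R]) ((1 - x) `^ (a - 1))%:E = (a^-1)%:E)%E.
Proof.
move=> a0; rewrite -integral_itv_bndo_bndc; last first.
  by apply/measurable_EFinP; exact: measurable_onem_powR.
rewrite -bigcup_itv_onem_harmonic.
(* The index [n.+1] makes the right endpoint [1 - 1 / (n + 2)], strictly between 0 and 1. *)
pose F n : set R := `[0, 1 - harmonic n.+1]%classic.
have h : (\int[lam]_(x in F n) ((1 - x) `^ (a - 1))%:E)%E @[n --> \oo] -->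
   (\int[lam]_(x in \bigcup_n F n) ((1 - x) `^ (a - 1))%:E)%E.
  apply: ge0_nondecreasing_set_cvg_integral.
  - apply/nondecreasing_seqP => n; apply/subsetPset => x /=; rewrite /F /= !in_itv/= => /andP[-> xn] /=.
    by apply: (le_trans xn); rewrite lerB// lef_pV2 ?posrE ?ltr0n// ler_nat.
  - by move=> n; exact: measurable_itv.
  - by move=> n; apply/measurable_EFinP; exact: measurable_onem_powR.
  - by move=> n x _; rewrite lee_fin powR_ge0.
apply: (cvg_unique _ h); first exact: ereal_hausdorff.
have -> : (fun n => (\int[lam]_(x in F n) ((1 - x) `^ (a - 1))%:E)%E) =
    (fun n => (a^-1 - a^-1 * (harmonic n.+1) `^ a)%:E).
  apply/funext => n; rewrite integral_onem_powR_itv//.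
    by congr (_%:E); congr (_ - _ * _ `^ _); ring.
  rewrite subr_gt0 ltrBlDr ltrDl harmonic_gt0 andbT /= invf_lt1 ?ltr0n// ltr1n//.
apply: cvg_EFin; first exact: nearW.
rewrite -[X in _ --> X]subr0 -[X in _ - X](mulr0 a^-1).
apply: cvgB; first exact: cvg_cst.
apply: cvgM; first exact: cvg_cst.
have /cvg_at_rightP := powR_cvg0 a0; apply; split; first by move=> n; exact: harmonic_gt0.
by rewrite (cvg_shiftS (@harmonic R)); exact: cvg_harmonic.
Qed.

Definition beta_dens (th x : R) : R := th * (1 - x) `^ (th - 1).

Lemma integral_beta_dens (th : R) : 0 < th ->
  (\int[lam]_(x in `[0%R, (1)%R]) (beta_dens th x)%:E = 1)%E.
Proof.
move=> th0; under eq_integral do rewrite /beta_dens EFinM.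
rewrite ge0_integralZl//=; last 3 first.
- by apply/measurable_EFinP; exact: measurable_onem_powR.
- by move=> x _; rewrite lee_fin powR_ge0.
- by rewrite lee_fin ltW.
by rewrite integral_onem_powR// -EFinM divff// gt_eqF.
Qed.

Lemma integrable_beta_dens (th : R) : 0 < th ->
  lam.-integrable `[0, 1] (EFin \o beta_dens th).
Proof.
move=> th0; apply/integrableP; split.
  by apply/measurable_EFinP/measurable_funM => //; exact: measurable_onem_powR.
rewrite (_ : (\int[_]_(x in _) _)%E = (\int[lam]_(x in `[0%R, (1)%R]) (beta_dens th x)%:E)%E).
  by rewrite integral_beta_dens// ltry.
apply: eq_integral => x _; rewrite /= ger0_norm// /beta_dens mulr_ge0 ?powR_ge0// ltW//.
Qed.

Definition bdd_measurable (h : R -> R) : Prop :=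
  measurable_fun (`[0, 1]%classic : set R) h /\
  exists B : R, forall x, 0 <= x <= 1 -> `|h x| <= B.

Lemma bdd_measurableD h k : bdd_measurable h -> bdd_measurable k ->
  bdd_measurable (fun x => h x + k x).
Proof.
move=> [mh [B hB]] [mk [C kC]]; split; first exact: measurable_funD.
by exists (B + C) => x x01; rewrite (le_trans (ler_normD _ _))// lerD ?hB ?kC.
Qed.

Lemma bdd_measurable_monomial (c : R) m : bdd_measurable (fun x => c * (1 - x) ^+ m).
Proof.
split.
  apply: measurable_funM => //; apply: measurable_funX; exact: measurable_funB.
exists `|c| => x /andP[x0 x1]; rewrite normrM ler_piMr// ger0_norm ?exprn_ge0 ?subr_ge0//.
by rewrite exprn_ile1 ?subr_ge0// lerBlDr lerDl.
Qed.

(** Provides the measurability of inner Beta integrals, which are uniform limits of polynomials. *)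
Lemma bdd_measurable_lim (K : R -> R) :
  (forall n : nat, exists2 J, bdd_measurable J & forall x, 0 <= x <= 1 -> `|K x - J x| <= harmonic n) ->
  bdd_measurable K.
Proof.
move=> approxK.
have /choice[J JJ] : forall n : nat, exists J, bdd_measurable J /\
    forall x, 0 <= x <= 1 -> `|K x - J x| <= harmonic n.
  by move=> n; have [J JP JK] := approxK n; exists J.
have JP n := (JJ n).1; have JK n := (JJ n).2; split.
  apply: (@measurable_fun_cvg _ _ _ _ J) => [n|x].
    by case: (JP n).
  rewrite /= in_itv/= => x01; apply/cvgrPdist_le => e e0.
  have /cvgr0_norm_le/(_ _ e0) := @cvg_harmonic R.
  apply: filterS => n; rewrite ger0_norm ?harmonic_ge0//.
  exact: le_trans (JK n x x01).
have [_ [B hB]] := JP 0%N; exists (harmonic 0 + B) => x x01.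
rewrite -(subrK (J 0%N x) (K x)) (le_trans (ler_normD _ _))// lerD ?hB//.
exact: JK.
Qed.

Lemma integrable_beta_densM (th : R) h : 0 < th -> bdd_measurable h ->
  lam.-integrable `[0, 1] (EFin \o (fun x => beta_dens th x * h x)).
Proof.
move=> th0 [mh [B hB]].
have md : measurable_fun (`[0, 1]%classic : set R) (beta_dens th).
  by apply: measurable_funM => //; exact: measurable_onem_powR.
apply: (@le_integrable _ _ _ lam _ _ _ (fun x => B%:E * (EFin \o beta_dens th) x)%E) => //.
- by apply/measurable_EFinP; exact: measurable_funM.
- move=> x; rewrite /= in_itv/= => x01; rewrite lee_fin !normrM mulrC.
  by rewrite ler_wpM2r// (le_trans (hB _ x01))// ler_norm.
- by apply: integrableZl => //; exact: integrable_beta_dens.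
Qed.

Lemma beta1E (th : R) h : 0 < th ->
  beta1 th h = Rintegral lam `[0, 1]%classic (fun x => beta_dens th x * h x).
Proof. by move=> th0; rewrite /beta1 th0. Qed.

Lemma beta1D (th : R) h k : 0 < th -> bdd_measurable h -> bdd_measurable k ->
  beta1 th (fun x => h x + k x) = beta1 th h + beta1 th k.
Proof.
move=> th0 nh nk; rewrite !beta1E// -RintegralD//; [|exact: integrable_beta_densM..].
by apply: eq_Rintegral => x _; rewrite mulrDr.
Qed.

Lemma beta1_monomial (th c : R) m : 0 < th ->
  beta1 th (fun x => c * (1 - x) ^+ m) = c * (th / (th + m%:R)).
Proof.
move=> th0; have thm : 0 < th + m%:R by rewrite ltr_wpDr.
have mm p : measurable_fun (`[0, 1[%classic : set R) (fun x : R => (c * th * (1 - x) `^ p)%:E).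
  by apply/measurable_EFinP/measurable_funM => //; exact: measurable_onem_powR.
rewrite beta1E// /Rintegral.
transitivity (fine (\int[lam]_(x in `[0%R, 1%R]) (c * th * (1 - x) `^ (th + m%:R - 1))%:E)%E).
  (* The endpoint 1 is dropped, since the addition rule for exponents carries a side condition when
     the base is 0. *)
  congr fine; rewrite -integral_itv_bndo_bndc; last first.
    apply/measurable_EFinP/measurable_funM; last first.
      by apply: measurable_funM => //; apply: measurable_funX; exact: measurable_funB.
    by apply: measurable_funM => //; exact: measurable_onem_powR.
  rewrite -[RHS]integral_itv_bndo_bndc//.
  apply: eq_integral => x; rewrite inE/= in_itv/= => /andP[x0 x1]; congr (_%:E).
  rewrite addrAC powRD; last by rewrite subr_eq0 [1 == _]eq_sym (lt_eqF x1) implybT.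
  by rewrite powR_mulrn ?subr_ge0 ?ltW// /beta_dens; ring.
under eq_integral do rewrite EFinM.
rewrite integralZl//=; last first.
  apply/integrableP; split; first by apply/measurable_EFinP; exact: measurable_onem_powR.
  rewrite (_ : (\int[_]_(x in _) _)%E = (\int[lam]_(x in `[0%R, (1)%R]) ((1 - x) `^ (th + m%:R - 1))%:E)%E).
    by rewrite integral_onem_powR// ltry.
  by apply: eq_integral => x _; rewrite /= ger0_norm// powR_ge0.
by rewrite integral_onem_powR//=; ring.
Qed.

Lemma beta1_dist (th e : R) h k : 0 < th -> bdd_measurable h -> bdd_measurable k ->
  (forall x, 0 <= x <= 1 -> `|h x - k x| <= e) -> `|beta1 th h - beta1 th k| <= e.
Proof.
move=> th0 nh nk hk; rewrite !beta1E// -RintegralB//; [|exact: integrable_beta_densM..].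
have ih := integrable_beta_densM th0 nh; have ik := integrable_beta_densM th0 nk.
have ihk : lam.-integrable `[0, 1] (EFin \o (fun x => beta_dens th x * h x - beta_dens th x * k x)).
  move: ih ik; set a := (fun x => _ * h x); set b := (fun x => _ * k x) => ia ib.
  rewrite (_ : EFin \o _ = ((EFin \o a) \- (EFin \o b))%E); last by apply/funext.
  exact: integrableB.
apply: (le_trans (le_normr_Rintegral _ _)) => //.
have d0 x : 0 <= beta_dens th x by rewrite /beta_dens mulr_ge0 ?powR_ge0// ltW.
have ie : lam.-integrable `[0, 1] (EFin \o (fun x => e * beta_dens th x)).
  by apply: (@integrableZl _ _ _ lam _ _ e (EFin \o beta_dens th)) => //; exact: integrable_beta_dens.
apply: (@le_trans _ _ (Rintegral lam `[0, 1]%classic (fun x => e * beta_dens th x))).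
  apply: le_Rintegral => //.
    exact: (integrable_abse ihk).
  move=> x; rewrite /= in_itv/= => x01.
  by rewrite -mulrBr normrM (ger0_norm (d0 x)) mulrC ler_wpM2r// hk.
rewrite RintegralZl//; last exact: integrable_beta_dens.
by rewrite /Rintegral integral_beta_dens// mulr1.
Qed.

End beta_density.

(** * Bernstein approximation *)

Section bernstein.
Variable R : realType.
Implicit Types (phi psi : nat -> R) (x : R).

(* The expectation of phi at a binomial(N, x) variable, conditioning on the first trial. *)
Fixpoint bern (N : nat) phi x : R :=
  if N is N'.+1 then x * bern N' (fun i => phi i.+1) x + (1 - x) * bern N' phi x
  else phi 0%N.

Lemma bern_cst N (c : R) x : bern N (fun=> c) x = c.
Proof. by elim: N => //= N IH; rewrite IH; ring. Qed.

Lemma eq_bern N phi psi x : phi =1 psi -> bern N phi x = bern N psi x.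
Proof. by move=> /funext ->. Qed.

Lemma bern_linear N (a b : R) phi psi x :
  bern N (fun i => a * phi i + b * psi i) x = a * bern N phi x + b * bern N psi x.
Proof.
by elim: N phi psi => //= N IH phi psi; rewrite (IH (fun i => phi i.+1) (fun i => psi i.+1)) IH; ring.
Qed.

Lemma ler_bern N phi psi x : 0 <= x <= 1 -> (forall i, (i <= N)%N -> phi i <= psi i) ->
  bern N phi x <= bern N psi x.
Proof.
move=> /andP[x0 x1]; elim: N phi psi => [|N IH] phi psi pp /=; first exact: pp.
by rewrite lerD// ler_wpM2l ?subr_ge0//; apply: IH => i iN; apply: pp => //; exact: ltnW.
Qed.


(** The offset [c] is what the induction needs: conditioning on the first trial replaces it by
    [c + 1 - x] or [c - x], and the average of the two squares is [c ^+ 2 + x * (1 - x)]. At [c = 0]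
    this is the binomial variance. *)
Lemma bern_variance N (c : R) x :
  bern N (fun i => (i%:R - N%:R * x + c) ^+ 2) x = N%:R * x * (1 - x) + c ^+ 2.
Proof.
elim: N c => [|N IH] c; first by rewrite /= !mul0r subrr !add0r.
rewrite [LHS]/= (@eq_bern _ _ (fun i => (i%:R - N%:R * x + (c + 1 - x)) ^+ 2)); last first.
  by move=> i; congr (_ ^+ 2); rewrite -!natr1; ring.
rewrite [X in _ + _ * X](@eq_bern _ _ (fun i => (i%:R - N%:R * x + (c - x)) ^+ 2)); last first.
  by move=> i; congr (_ ^+ 2); rewrite -!natr1; ring.
by rewrite !IH -natr1; ring.
Qed.

(** Chebyshev's argument: nodes within [d] of [x] cost at most [e]; at the others the error [2 * B]
    is at most [2 * B / d ^+ 2] times the squared distance, whose mean is [x * (1 - x) / N]. *)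
Lemma bernstein_approx (h : R -> R) (B e d : R) N x : 0 < d -> (0 < N)%N -> 0 <= x <= 1 ->
  (forall y, 0 <= y <= 1 -> `|h y| <= B) ->
  (forall y, 0 <= y <= 1 -> `|x - y| <= d -> `|h x - h y| <= e) ->
  `|h x - bern N (fun i => h (i%:R / N%:R)) x| <= e + 2 * B / (d ^+ 2 * N%:R).
Proof.
move=> d0 N0 x01 hB hd.
have NR : 0 < N%:R :> R by rewrite ltr0n.
have e0 : 0 <= e by apply: (le_trans (normr_ge0 _) (hd x x01 _)); rewrite subrr normr0 ltW.
have B0 : 0 <= B by exact: le_trans (hB _ x01).
pose q : R := 2 * B / (d ^+ 2).
have q0 : 0 <= q by apply: divr_ge0; [rewrite mulr_ge0 | rewrite exprn_ge0// ltW].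
have key i : (i <= N)%N -> `|h x - h (i%:R / N%:R)| <= e + q * N%:R ^- 2 * (i%:R - N%:R * x + 0) ^+ 2.
  move=> iN; set y := i%:R / N%:R.
  have y01 : 0 <= y <= 1 by rewrite divr_ge0//= ler_pdivrMr// mul1r ler_nat.
  have -> : q * N%:R ^- 2 * (i%:R - N%:R * x + 0) ^+ 2 = q * (x - y) ^+ 2.
    by rewrite /y; field; rewrite gt_eqF.
  have [xy|xy] := leP `|x - y| d.
    by apply: (le_trans (hd _ y01 xy)); rewrite lerDl mulr_ge0// sqr_ge0.
  have : d ^+ 2 <= (x - y) ^+ 2.
    by rewrite -[leRHS]real_normK ?num_real// lerXn2r// ?nnegrE ?ltW.
  have d20 : 0 < d ^+ 2 by rewrite exprn_gt0.
  move=> dxy; apply: (@le_trans _ _ (2 * B)).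
    by rewrite (le_trans (ler_normB _ _))// mulr_natl mulr2n lerD ?hB.
  apply: (@le_trans _ _ (q * (x - y) ^+ 2)); last by rewrite lerDr.
  apply: (@le_trans _ _ (q * d ^+ 2)); last by rewrite ler_wpM2l.
  by rewrite /q divfK// gt_eqF.
pose D i := h x - h (i%:R / N%:R).
have -> : h x - bern N (fun i => h (i%:R / N%:R)) x = bern N D x.
  rewrite -{1}(bern_cst N (h x) x).
  transitivity (bern N (fun i => 1 * h x + -1 * h (i%:R / N%:R)) x).
    by rewrite bern_linear mul1r mulN1r.
  by apply: eq_bern => i; rewrite mul1r mulN1r.
pose U i := e + q * N%:R ^- 2 * (i%:R - N%:R * x + 0) ^+ 2.
have UE : bern N U x <= e + q / N%:R.
  rewrite (@eq_bern _ _ (fun i => 1 * e + q * N%:R ^- 2 * (i%:R - N%:R * x + 0) ^+ 2)); last first.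
    by move=> i; rewrite mul1r.
  rewrite bern_linear bern_cst bern_variance mul1r lerD2l expr0n addr0.
  have -> : q * N%:R ^- 2 * (N%:R * x * (1 - x)) = q / N%:R * (x * (1 - x)).
    by field; rewrite gt_eqF.
  rewrite ler_piMr//; first by rewrite divr_ge0.
  by case/andP: x01 => x0 x1; rewrite mulr_ile1 ?subr_ge0// lerBlDr lerDl.
have -> : 2 * B / (d ^+ 2 * N%:R) = q / N%:R by rewrite /q; field; rewrite !gt_eqF.
apply: le_trans UE; rewrite ler_norml -[X in X <= _ <= _]mulN1r.
have -> : -1 * bern N U x = bern N (fun i => - U i) x.
  transitivity (bern N (fun i => -1 * U i + 0 * U i) x); first by rewrite bern_linear mul0r addr0.
  by apply: eq_bern => i; rewrite mul0r addr0 mulN1r.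
apply/andP; split; apply: ler_bern => // i iN;
  by have := key i iN; rewrite ler_norml => /andP[].
Qed.

End bernstein.

(** * Uniform approximation by combinations of monomials *)

Section monomial_span.
Variable R : realType.
Implicit Types (ths : seq R) (H : seq R -> R).

(** Pairs a combination of monomials with the value obtained by replacing each monomial by its
    moment. Being a relation, it does not require the representation of the function to be
    unique. *)
Inductive mspan (ths : seq R) : (seq R -> R) -> R -> Prop :=
| mspan0 : mspan ths (fun=> 0) 0
| mspanS c ms H v : size ms = size ths -> mspan ths H v ->
    mspan ths (fun s => c * mono ms s + H s) (c * moment_factor ths ms + v).

Lemma eq_mspan ths H v H' v' : mspan ths H v -> H =1 H' -> v = v' -> mspan ths H' v'.
Proof. by move=> + /funext <- <-. Qed.

Lemma mspanD ths H v H' v' : mspan ths H v -> mspan ths H' v' ->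
  mspan ths (fun s => H s + H' s) (v + v').
Proof.
move=> + s'; elim=> [|c ms {}H {}v sz s IH].
  by apply: (eq_mspan s') => [z|]; rewrite add0r.
by apply: (eq_mspan (mspanS c sz IH)) => [z|]; rewrite addrA.
Qed.

Lemma mspanZ ths a H v : mspan ths H v -> mspan ths (fun s => a * H s) (a * v).
Proof.
elim=> [|c ms {}H {}v sz s IH].
  by apply: (eq_mspan (mspan0 ths)) => [z|]; rewrite mulr0.
by apply: (eq_mspan (mspanS (a * c) sz IH)) => [z|]; rewrite mulrDr mulrA.
Qed.

Definition in_mspan ths H := exists v, mspan ths H v.

Lemma in_mspanM th ths H : in_mspan (th :: ths) H ->
  in_mspan (th :: ths) (fun s => head 0 s * H s).
Proof.
move=> [v]; elim=> [|c [|m ms] {}H {}v //= [sz] s [v' IH]].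
  by exists 0; apply: (eq_mspan (mspan0 _)) => // z; rewrite mulr0.
exists (c * moment_factor (th :: ths) (m.+1 :: ms) + v').
have sz' : size (m.+1 :: ms) = size (th :: ths) by rewrite /= sz.
apply: (eq_mspan (mspanS c sz' IH)) => // z.
by rewrite !mono_cons exprS; ring.
Qed.

Lemma in_mspan_behead th ths H : in_mspan ths H -> in_mspan (th :: ths) (fun s => H (behead s)).
Proof.
move=> [v]; elim=> [|c ms {}H {}v sz s [v' IH]]; first by exists 0; exact: mspan0.
exists (c * moment_factor (th :: ths) (0%N :: ms) + v').
have sz' : size (0%N :: ms) = size (th :: ths) by rewrite /= sz.
by apply: (eq_mspan (mspanS c sz' IH)) => // z; rewrite mono_cons expr0 mul1r.
Qed.

Lemma in_mspan_bern th ths N (H : nat -> seq R -> R) : (forall i, in_mspan ths (H i)) ->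
  in_mspan (th :: ths) (fun s => bern N (fun i => H i (behead s)) (head 0 s)).
Proof.
elim: N H => [|N IH] H sH /=; first exact: in_mspan_behead.
have [v1 s1] := in_mspanM (IH _ (fun i => sH i.+1)).
have [v2 s2] := IH _ sH; have [v3 s3] := in_mspanM (IH _ sH).
exists (v1 + (v2 + -1 * v3)).
by apply: (eq_mspan (mspanD s1 (mspanD s2 (mspanZ (-1) s3)))) => // z; ring.
Qed.

Definition approximable ths H : Prop := forall e, 0 < e -> exists2 H', in_mspan ths H' &
  forall s, unit_seq s -> size s = size ths -> `|H s - H' s| <= e.

Definition unif_cont_seq (k : nat) H : Prop := forall e, 0 < e -> exists2 d, 0 < d &
  forall s t, unit_seq s -> unit_seq t -> size s = k -> size t = k ->
    all2 (fun x y => `|x - y| <= d) s t -> `|H s - H t| <= e.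

(** Induction on the number of variables: Bernstein in the first one, while the slices at the nodes
    [i / N] are approximated by the induction hypothesis. *)
Lemma unif_cont_approximable ths H B : (forall s, unit_seq s -> size s = size ths -> `|H s| <= B) ->
  unif_cont_seq (size ths) H -> approximable ths H.
Proof.
elim: ths H => [|th ths IH] H HB Huc e e0.
  exists (fun s => H [::] * mono [::] s + 0).
    by exists (H [::] * moment_factor [::] [::] + 0); apply: mspanS => //; exact: mspan0.
  by move=> [|//] _ _; rewrite /= mulr1 addr0 subrr normr0 ltW.
have e40 : 0 < e / 4 by rewrite divr_gt0.
have [d d0 Hd] := Huc _ e40.
pose q := 2 * B / d ^+ 2.
(* The budget is [e / 4] for the oscillation, [e / 4] for the variance term and [e / 2] for the
   slices. [|q|] appears because the sign of [B] is not known. *)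
have [N N0 qN] : exists2 N, (0 < N)%N & q / N%:R <= e / 4.
  exists (Num.truncn (`|q| / (e / 4))).+1 => //.
  rewrite ler_pdivrMr ?ltr0n// mulrC -ler_pdivrMr//.
  apply: le_trans (ltW (truncnS_gt _)).
  by apply: ler_wpM2r; [rewrite invr_ge0 ltW | exact: ler_norm].
have i01 i : (i <= N)%N -> 0 <= (i%:R / N%:R : R) <= 1.
  by move=> iN; rewrite divr_ge0//= ler_pdivrMr ?ltr0n// mul1r ler_nat.
have /choice[A AP] : forall i : nat, exists A, in_mspan ths A /\ ((i <= N)%N ->
    forall s, unit_seq s -> size s = size ths -> `|H (i%:R / N%:R :: s) - A s| <= e / 2).
  move=> i; have [iN|iN] := leqP i N; last by exists (fun=> 0); split => //; exists 0; exact: mspan0.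
  have /andP[y0 y1] := i01 i iN.
  have e20 : 0 < e / 2 by rewrite divr_gt0.
  have [||A [v sA] AH] := IH (fun s => H (i%:R / N%:R :: s)) _ _ _ e20.
  - by move=> s us ss; apply: HB; rewrite /= ?ss// /unit_seq /= y0 y1.
  - move=> e' e'0; have [d' d'0 Hd'] := Huc _ e'0; exists d' => // s t us ut ss st al.
    by apply: Hd'; rewrite /= ?ss ?st// /unit_seq /= ?y0 ?y1// subrr normr0 ltW.
  - by exists A; split => //; exists v.
exists (fun s => bern N (fun i => A i (behead s)) (head 0 s)).
  by apply: in_mspan_bern => i; case: (AP i).
move=> [//|x s] /= /andP[x01 us] [ss].
have h1 : `|H (x :: s) - bern N (fun i => H (i%:R / N%:R :: s)) x| <= e / 4 + q / N%:R.
  have -> : q / N%:R = 2 * B / (d ^+ 2 * N%:R).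
    rewrite /q; have : N%:R != 0 :> R by rewrite pnatr_eq0 -lt0n.
    by move=> NR0; field; rewrite (gt_eqF d0) NR0.
  apply: (bernstein_approx (h := fun y => H (y :: s))) => //.
    by move=> y y01; apply: HB; rewrite /= ?ss// /unit_seq /= y01.
  move=> y y01 xy; apply: Hd; rewrite /= ?ss// /unit_seq /= ?x01 ?y01// xy /=.
  elim: {us ss} s => //= z s ->; by rewrite subrr normr0 ltW.
have h2 : `|bern N (fun i => H (i%:R / N%:R :: s)) x - bern N (fun i => A i s) x| <= e / 2.
  have -> : bern N (fun i => H (i%:R / N%:R :: s)) x - bern N (fun i => A i s) x =
      bern N (fun i => 1 * H (i%:R / N%:R :: s) + -1 * A i s) x.
    by rewrite bern_linear mul1r mulN1r.
  rewrite ler_norml; apply/andP; split.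
    rewrite -(bern_cst N (- (e / 2)) x); apply: ler_bern => // i iN.
    by have := (AP i).2 iN s us ss; rewrite ler_norml mul1r mulN1r => /andP[].
  rewrite -[leRHS](bern_cst N (e / 2) x); apply: ler_bern => // i iN.
  by have := (AP i).2 iN s us ss; rewrite ler_norml mul1r mulN1r => /andP[].
set u := H _ in h1 *; set v := bern _ _ _ in h1 h2; set w' := bern _ _ _ in h2 *.
rewrite -(subrKA v); apply: (le_trans (ler_normD _ _)).
apply: (le_trans (lerD h1 h2)); lra.
Qed.

End monomial_span.

(** * Stick-breaking expectations *)

Section iterated_beta.
Variable R : realType.
Implicit Types (ths : seq R) (H : seq R -> R).

(* Expectation of H(W_1, ..., W_k) for independent W_j = 1 - X_j, X_j ~ Beta(1, th_j). *)
Fixpoint iter_beta ths H : R :=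
  if ths is th :: ths' then beta1 th (fun x => iter_beta ths' (fun s => H ((1 - x) :: s)))
  else H [::].

Lemma mspan_nil H v : mspan [::] H v -> v = H [::].
Proof.
elim=> // c ms {}H {}v /size0nil -> _ ->.
by rewrite /moment_factor /= big_nil.
Qed.

(** [J] integrates out all variables but the first: each term [c w^m mono ms] contributes
    [c * moment_factor ths ms * w^m], a polynomial whose Beta integral is explicit. *)
Lemma mspan_cons th ths H v : 0 < th -> mspan (th :: ths) H v -> exists J,
  [/\ forall w, mspan ths (fun s => H (w :: s)) (J w),
      bdd_measurable (fun x => J (1 - x)) & beta1 th (fun x => J (1 - x)) = v].
Proof.
move=> th0; elim=> [|c [|m ms] {}H {}v //= [sz] s [J [JH mJ bJ]]].
  exists (fun=> 0); split => [w||]; first exact: mspan0.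
    have := @bdd_measurable_monomial R 0 0.
    by rewrite (_ : (fun x => 0 * (1 - x) ^+ 0) = fun=> 0)//; apply/funext => x; rewrite mul0r.
  have := @beta1_monomial R th 0 0 th0.
  by rewrite (_ : (fun x => 0 * (1 - x) ^+ 0) = fun=> 0) ?mul0r//; apply/funext => x; rewrite mul0r.
pose c' := c * moment_factor ths ms.
have mJ' := bdd_measurable_monomial c' m.
exists (fun w => c' * w ^+ m + J w); split => [w||].
- apply: (eq_mspan (mspanS (c * w ^+ m) sz (JH w))) => [z|].
    by rewrite /=; ring.
  by rewrite /c'; ring.
- exact: (bdd_measurableD mJ' mJ).
- by rewrite (beta1D th0 mJ' mJ) beta1_monomial// bJ /c' moment_factor_cons; ring.
Qed.

Lemma approximable_cons th ths H w : 0 <= w <= 1 -> 0 < th -> approximable (th :: ths) H ->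
  approximable ths (fun s => H (w :: s)).
Proof.
move=> w01 th0 aH e e0; have [H' [v sH'] HH'] := aH e e0.
have [J [JH _ _]] := mspan_cons th0 sH'.
exists (fun s => H' (w :: s)); first by exists (J w).
by move=> s us ss; apply: HH'; rewrite /= ?ss// /unit_seq/= w01.
Qed.

(** [H'] serves the estimate, whereas approximability of [H] to every precision serves the
    measurability of the inner integral; both go through one induction. *)
Lemma iter_beta_dist ths H : all (fun th => 0 < th) ths -> approximable ths H ->
  forall H' v e, mspan ths H' v ->
    (forall s, unit_seq s -> size s = size ths -> `|H s - H' s| <= e) ->
    `|iter_beta ths H - v| <= e.
Proof.
elim: ths H => [|th ths IH] H /=; first by move=> _ _ H' v e /mspan_nil -> h; exact: h.
move=> /andP[th0 ths0] aH H' v e sH' HH'.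
have flip (x : R) : 0 <= x <= 1 -> 0 <= 1 - x <= 1.
  by move=> /andP[x0 x1]; rewrite subr_ge0 x1 lerBlDr lerDl x0.
have [J [JH mJ <-]] := mspan_cons th0 sH'.
apply: beta1_dist => //.
(* The induction hypothesis, applied to an approximation of precision [harmonic n], places the inner
   integral within that distance of the polynomial [Jn (1 - x)]. *)
- apply: bdd_measurable_lim => n.
  have [Hn [vn sn] Hnn] := aH _ (harmonic_gt0 n).
  have [Jn [JnH mJn _]] := mspan_cons th0 sn.
  exists (fun x => Jn (1 - x)) => // x /flip w01.
  apply: (IH _ ths0 (approximable_cons w01 th0 aH) _ _ _ (JnH _)) => s us ss.
  by apply: Hnn; rewrite /= ?ss// /unit_seq/= w01.
- move=> x /flip w01.
  apply: (IH _ ths0 (approximable_cons w01 th0 aH) _ _ _ (JH _)) => s us ss.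
  by apply: HH'; rewrite /= ?ss// /unit_seq/= w01.
Qed.

Lemma beta1_cst (th c : R) : beta1 th (fun=> c) = c.
Proof.
have [th0|th0] := ltP 0 th; last by rewrite /beta1 ltNge th0.
have := @beta1_monomial R th c 0 th0.
rewrite (_ : (fun x => c * (1 - x) ^+ 0) = fun=> c); last by apply/funext => x; rewrite mulr1.
by rewrite addr0 divff ?mulr1// gt_eqF.
Qed.

Lemma gem_rec_iter ths rem acc (g : seq R -> R) :
  gem_rec ths rem acc g = iter_beta ths (fun s => g (rev acc ++ stick rem s)).
Proof.
elim: ths rem acc => [|th ths IH] rem acc /=; first by rewrite cats0.
congr beta1; apply/funext => x; rewrite IH; congr iter_beta; apply/funext => s.
rewrite rev_cons cat_rcons; congr (g (_ ++ _ :: _)).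
by rewrite opprB addrC subrK.
Qed.

Definition row_of_seq k (s : seq R) : 'rV[R]_k := \row_(i < k) nth 0 s i.

Lemma gem_exp_iter k (th : 'I_k -> R) (g : 'rV[R]_k -> R) :
  gem_exp th g = iter_beta [seq th i | i <- enum 'I_k] (fun s => g (row_of_seq k (stick 1 s))).
Proof. by rewrite /gem_exp gem_rec_iter. Qed.

Lemma gem_exp_cst k (th : 'I_k -> R) (c : R) : gem_exp th (fun=> c) = c.
Proof.
rewrite gem_exp_iter; elim: [seq th i | i <- enum 'I_k] => //= t ths IH.
by rewrite IH beta1_cst.
Qed.

Lemma stick_unit (rem : R) (s : seq R) : 0 <= rem <= 1 -> unit_seq s -> unit_seq (stick rem s).
Proof.
elim: s rem => //= w s IH rem /andP[r0 r1] /andP[/andP[w0 w1] us].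
have w10 : 0 <= 1 - w by rewrite subr_ge0.
rewrite /unit_seq /= mulr_ge0//= mulr_ile1//=; last by rewrite lerBlDr lerDl.
by apply: IH => //; rewrite mulr_ge0//= mulr_ile1.
Qed.

(** The two sticks may start with different remainders, because after one break the remainders
    differ by up to [e + d]. *)
Lemma stick_lipschitz (d e rem rem' : R) (s t : seq R) : 0 <= d -> `|rem - rem'| <= e ->
  0 <= rem <= 1 -> 0 <= rem' <= 1 -> unit_seq s -> unit_seq t ->
  all2 (fun x y => `|x - y| <= d) s t ->
  all2 (fun x y => `|x - y| <= e + (size s)%:R * d) (stick rem s) (stick rem' t).
Proof.
move=> d0; elim: s t e rem rem' => [|x s IH] [|y t] e rem rem' //= re r01 r01'.
move=> /andP[/andP[x0 x1] us] /andP[/andP[y0 y1] ut] /andP[xy al].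
have [r0 r1] := andP r01; have [r0' r1'] := andP r01'.
have e0 : 0 <= e := le_trans (normr_ge0 _) re.
have step (u v : R) : 0 <= u <= 1 -> 0 <= v <= 1 -> `|u - v| <= d -> `|rem * u - rem' * v| <= e + d.
  move=> /andP[u0 u1] /andP[v0 v1] uv.
  have -> : rem * u - rem' * v = (rem - rem') * u + rem' * (u - v) by ring.
  rewrite (le_trans (ler_normD _ _))// lerD//.
    by rewrite normrM (ger0_norm u0) -[leRHS]mulr1 ler_pM.
  by rewrite normrM (ger0_norm r0') -[leRHS]mul1r ler_pM.
apply/andP; split.
  have := step (1 - x) (1 - y); rewrite !subr_ge0 !lerBlDr !lerDl x0 x1 y0 y1.
  rewrite (_ : 1 - x - (1 - y) = y - x); last by ring.
  rewrite distrC => /(_ isT isT xy) h; apply: (le_trans h).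
  by rewrite lerD2l -natr1 mulrDl mul1r lerDr mulr_ge0.
have -> : e + (size s).+1%:R * d = (e + d) + (size s)%:R * d by rewrite -natr1; ring.
apply: IH => //; first by apply: step; rewrite ?x0 ?y0.
  by rewrite mulr_ge0//= mulr_ile1.
by rewrite mulr_ge0//= mulr_ile1.
Qed.

End iterated_beta.

(** * Uniform continuity on the unit cube *)

Section cube.
Variable R : realType.

Lemma unit_cube_compact k : compact (@unit_cube R k).
Proof.
have := @rV_compact R k (fun=> `[0, 1]%classic) (fun=> @segment_compact R 0 1).
by rewrite (_ : [set v | _] = unit_cube (R := R) (k := k)).
Qed.

(** Heine-Cantor, with compactness in its near-covering form. Continuity is only relative to the
    cube, so both points are kept in it; each of the two distances takes half of the radius [r]. *)
Lemma cube_unif_cont k (g : 'rV[R]_k -> R) : {within @unit_cube R k, continuous g} ->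
  forall e, 0 < e -> exists2 d, 0 < d & forall p q, @unit_cube R k p -> @unit_cube R k q ->
    (forall i, `|p ord0 i - q ord0 i| <= d) -> `|g p - g q| <= e.
Proof.
move=> /subspace_continuousP cg e e0.
have nc := (compact_near_coveringP _).1 (@unit_cube_compact k).
have e20 : 0 < e / 2 by rewrite divr_gt0.
pose P (d : R) (p : 'rV[R]_k) := unit_cube p -> forall q, unit_cube q ->
  (forall i, `|p ord0 i - q ord0 i| <= d) -> `|g p - g q| <= e.
have h : \forall d \near (0 : R)^'+, @unit_cube R k `<=` P d.
  apply: nc => x cx.
  have /cvgrPdist_lt/(_ _ e20) := cg x cx.
  rewrite near_withinE => /nbhs_ballP[r /= r0 xr].
  have r20 : 0 < r / 2 by rewrite divr_gt0.
  exists (ball x (r / 2), [set d | d < r / 2]).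
    by split; [exact: nbhsx_ballx | exact: nbhs_right_lt].
  move=> [p d] /= [[_ xp] dr] cp q cq pq.
  have bp : ball x r p.
    split => // i j; have := xp i j; rewrite /ball /= => h.
    by apply: (lt_le_trans h); lra.
  have bq : ball x r q.
    split => // i j; have := xp i j; rewrite /ball /= !ord1 => h.
    have := pq j; have := ler_normD (x ord0 j - p ord0 j) (p ord0 j - q ord0 j).
    by rewrite subrKA => h1 h2; lra.
  have gp := xr _ bp cp; have gq := xr _ bq cq.
  have := ler_normD (g p - g x) (g x - g q).
  by rewrite subrKA (distrC (g p) (g x)) => gpq; move: gp gq gpq; lra.
have h0 : \forall d \near (0 : R)^'+, (@unit_cube R k `<=` P d) /\ 0 < d.
  by apply: filterI => //; exact: nbhs_right_gt.
have [d [hd d0]] := @filter_ex _ _ (at_right_proper_filter 0) _ h0.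
by exists d => // p q cp cq; exact: (hd p cp cp q cq).
Qed.

End cube.

(** * Discrete limits and path weights *)

Lemma all2_nth (T : Type) (x0 : T) (r : T -> T -> bool) s t i :
  all2 r s t -> (i < size s)%N -> r (nth x0 s i) (nth x0 t i).
Proof. by elim: s t i => [|x s IH] [|y t] [|i] //= /andP[xy al] //; exact: IH. Qed.

Lemma row_of_seq_cube (R : realType) k (s : seq R) : unit_seq s -> unit_cube (row_of_seq k s).
Proof.
move=> us i; rewrite mxE; have [si|si] := ltnP i (size s); first exact: (allP us _ (mem_nth _ si)).
by rewrite nth_default// lexx ler01.
Qed.

Lemma stick_approximable (R : realType) (ths : seq R) k (g : 'rV[R]_k -> R) : size ths = k ->
  bcont g -> approximable ths (fun s => g (row_of_seq k (stick 1 s))).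
Proof.
move=> sk [cg [B gB]].
have u1 : 0 <= (1 : R) <= 1 by rewrite ler01 lexx.
apply: (@unif_cont_approximable _ _ _ B) => [s us _|e e0].
  by apply/gB/row_of_seq_cube/stick_unit.
have [d d0 gd] := cube_unif_cont cg e0.
have k0 : 0 < k.+1%:R :> R by rewrite ltr0n.
(* Stick breaking is [k]-Lipschitz in the sup distance; [k.+1] also covers [k = 0]. *)
exists (d / k.+1%:R); first by rewrite divr_gt0.
move=> s t us ut ss st al; apply: gd; try by apply/row_of_seq_cube/stick_unit.
move=> i; rewrite !mxE.
have dk : 0 <= d / k.+1%:R by rewrite divr_ge0// ltW.
have := @stick_lipschitz R _ 0 1 1 s t dk; rewrite subrr normr0 !lexx ler01 => /(_ isT isT isT us ut al) al'.
have := all2_nth 0 (i := i) al'; rewrite size_stick ss sk ltn_ord => /(_ isT) h; apply: (le_trans h).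
by rewrite add0r mulrCA -[leRHS]mulr1 ler_pM2l// ler_pdivrMr// mul1r ler_nat.
Qed.

Section discrete_limit.
Variable R : realType.

Lemma sum_indicator (Z : eqType) (r : seq Z) (y : Z) : uniq r ->
  \sum_(z <- r) (y == z)%:R = (y \in r)%:R :> R.
Proof.
elim: r => [|z r IH] /=; first by rewrite big_nil.
move=> /andP[zr ur]; rewrite big_cons IH// inE; case: eqVneq => [->|_]; last by rewrite add0r.
by rewrite (negbTE zr) addr0.
Qed.

Lemma bdd_on_indicator (T : choiceType) (D : set T) (Z : eqType) (Y : T -> Z) z :
  bdd_on D (fun t => (Y t == z)%:R : R).
Proof. by exists 1 => t _; case: eqP; rewrite ?normr0 ?normr1. Qed.

(** The part of [F] that is left out equals [F] where [Y] avoids [r] and 0 elsewhere, so it is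
    bounded by [B] times the indicator of that event. *)
Lemma wmean_truncate (T : choiceType) (Z : eqType) (D : set T) (w F : T -> R) (Y : T -> Z) (B : R)
    (r : seq Z) : pmf_on D w -> (forall t, D t -> `|F t| <= B) -> uniq r ->
  `|wmean D w F - \sum_(z <- r) wmean D w (fun t => (Y t == z)%:R * F t)| <=
  B * (1 - \sum_(z <- r) wmean D w (fun t => (Y t == z)%:R)).
Proof.
move=> wP FB ur; have bF : bdd_on D F by exists B.
have bi z := bdd_on_indicator D Y z.
have bs : bdd_on D (fun t => \sum_(z <- r) (Y t == z)%:R : R).
  exact: (bdd_on_sum r bi).
have biF z := bdd_onM (bi z) bF.
rewrite -(wmean_sum wP r biF) -(wmean_sum wP r bi) -(wmeanB wP bF (bdd_on_sum r biF)).
have := wmeanB wP (bdd_on_cst D 1) bs; rewrite (wmean_cst wP) => <-.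
have b1 : bdd_on D (fun t => 1 - \sum_(z <- r) (Y t == z)%:R : R).
  apply: (bdd_onD (bdd_on_cst _ 1)).
  have := bdd_onZ (-1) bs; by under [X in bdd_on _ X]eq_fun do rewrite mulN1r.
rewrite -(wmeanZ wP) //; apply: (ler_norm_wmean wP); first exact: bdd_onZ.
move=> t Dt; rewrite -big_distrl /= sum_indicator//.
case: (Y t \in r); rewrite ?mul1r ?mul0r ?subrr ?subr0 ?normr0 ?mulr0 ?mulr1 ?FB//.
Qed.

Lemma pmf_tight (Z : choiceType) (q : Z -> R) (d : R) : pmf_on [set: Z] q -> 0 < d ->
  exists2 r : seq Z, uniq r & 1 - d <= \sum_(z <- r) q z.
Proof.
move=> [q0 q1] d0.
have : ((1 - d)%:E < \esum_(z in [set: Z]) (q z)%:E)%E by rewrite q1 lte_fin gtrBl.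
move=> /ereal_sup_gt[_ [A [finA _] <-]] /ltW h.
exists (finmap.enum_fset (fset_set A)); first exact: finmap.fset_uniq.
by move: h; rewrite fsbig_finite//= sumEFin lee_fin.
Qed.

Lemma cvg_sum_seq (Z : Type) (r : seq Z) (u : nat -> Z -> R) (l : Z -> R) :
  (forall z, (fun n => u n z) @ \oo --> l z) ->
  (fun n => \sum_(z <- r) u n z) @ \oo --> \sum_(z <- r) l z.
Proof.
move=> ul; elim: r => [|z r IH].
  by rewrite big_nil; under eq_fun do rewrite big_nil; exact: cvg_cst.
by rewrite big_cons; under eq_fun do rewrite big_cons; exact: cvgD.
Qed.

(* Scheffe's argument: pointwise convergence of the masses of Y to a probability
   vector implies tightness. *)
Lemma wmean_cvg_discrete (T Z : choiceType) (D : nat -> set T) (w F : T -> R) (Y : T -> Z)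
    (q g : Z -> R) (B : R) : 0 <= B ->
  (forall n, (0 < n)%N -> pmf_on (D n) w) -> pmf_on [set: Z] q ->
  (forall t, `|F t| <= B) -> (forall z, `|g z| <= B) ->
  (forall z, (fun n => wmean (D n) w (fun t => (Y t == z)%:R * F t)) @ \oo --> q z * g z) ->
  (forall z, (fun n => wmean (D n) w (fun t => (Y t == z)%:R)) @ \oo --> q z) ->
  (fun n => wmean (D n) w F) @ \oo --> wmean [set: Z] q g.
Proof.
move=> B0 wP qP FB gB cF c1; apply/cvgrPdist_le => e e0.
(* Truncating the limit law costs [B * d], comparing the finite sums [d], and truncating the law at
   time [n] costs [B * (2 * d)], its mass on [r] being at least [1 - 2 * d]. *)
have B1 : 0 < 3 * B + 1 by lra.
pose d := e / (3 * B + 1); have d0 : 0 < d by rewrite divr_gt0.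
have [r ur rq] := pmf_tight qP d0.
have /cvgrPdist_le/(_ _ d0) cS := cvg_sum_seq (r := r) cF.
have /cvgrPdist_le/(_ _ d0) cM := cvg_sum_seq (r := r) c1.
have delta z (h : Z -> R) : wmean [set: Z] q (fun y => (y == z)%:R * h y) = q z * h z.
  rewrite /wmean (@dsum_delta _ _ _ z)// ?eqxx ?mul1r// => y _ /negbTE ->.
  by rewrite mul0r mulr0.
have := wmean_truncate (F := g) (B := B) id qP (fun z _ => gB z) ur.
under eq_bigr do rewrite (delta _ g).
under [X in _ <= _ * (_ - X) -> _]eq_bigr => z _.
  rewrite (_ : wmean _ _ _ = q z); last first.
    by have := delta z (fun=> 1); rewrite mulr1 => <-; apply: eq_wmean => y _; rewrite mulr1.
  over.
move=> hq; near=> n.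
have n0 : (0 < n)%N by near: n; exists 1%N.
have := wmean_truncate (F := F) (B := B) Y (wP n n0) (fun t _ => FB t) ur.
have : `|\sum_(z <- r) q z * g z - \sum_(z <- r) wmean (D n) w (fun t => (Y t == z)%:R * F t)| <= d.
  by near: n.
have : `|\sum_(z <- r) q z - \sum_(z <- r) wmean (D n) w (fun t => (Y t == z)%:R)| <= d.
  by near: n.
move: hq; set a := wmean _ _ g; set b := \sum_(z <- r) q z * g z; set c := \sum_(z <- r) q z in rq *.
set a' := wmean _ _ F; set c' := \sum_(z <- r) wmean _ _ _; set b' := \sum_(z <- r) wmean _ _ _.
move=> h1 /ler_normlP[_ h2] h3 h4.
have dE : (3 * B + 1) * d = e by rewrite /d mulrC divfK// gt_eqF.
have : B * (1 - c) <= B * d by rewrite ler_wpM2l//; lra.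
have : B * (1 - c') <= B * (2 * d) by rewrite ler_wpM2l//; lra.
have := ler_normD (a - b) (b - a'); rewrite subrKA.
have := ler_normD (b - b') (b' - a'); rewrite subrKA (distrC b' a').
lra.
Unshelve. all: by end_near. Qed.

End discrete_limit.

Section path_weights.
Variables (R : realType) (X : countType).
Implicit Types (K : X -> X -> R) (mu : X -> R).

Lemma esum_seqS (k : nat) (a : seq X -> R) : (forall s, 0 <= a s) ->
  (\esum_(s in [set s | size s = k.+1]) (a s)%:E =
   \esum_(y in [set: X]) \esum_(s in [set s | size s = k]) (a (y :: s))%:E)%E.
Proof.
move=> a0; rewrite esum_esum; last by move=> *; rewrite lee_fin.
rewrite (@reindex_esum _ _ _ ([set: X] `*`` (fun=> [set s | size s = k])) _ (fun p => p.1 :: p.2))//.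
split.
- by move=> [y s] [_ /= ->].
- by move=> [y s] [y' s'] _ _ /= [-> ->].
- by move=> [//|y s] /= [ss]; exists (y, s).
Qed.

Lemma chain_weight_pmf K k y : stochastic K ->
  pmf_on [set s : seq X | size s = k] (chain_weight K y).
Proof.
move=> KP; have K0 a b : 0 <= K a b by case: (KP a) => h _; exact: h.
split=> [s _|]; first exact: chain_weight_ge0.
elim: k y => [|k IH] y.
  rewrite (_ : [set s | _] = [set [::]]); last by apply/seteqP; split => s /= => [/size0nil|->].
  by rewrite esum_set1.
rewrite esum_seqS; last by move=> s; exact: chain_weight_ge0.
case: (KP y) => _ <-; apply: eq_esum => z _ /=.
by rewrite ge0_esumZ// ?IH ?mule1// => s _; exact: chain_weight_ge0.
Qed.

Lemma path_weight_pmf K mu k : stochastic K -> pmf_on [set: X] mu ->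
  pmf_on [set s : seq X | size s = k] (path_weight mu K).
Proof.
move=> KP [m0 m1]; have K0 a b : 0 <= K a b by case: (KP a) => h _; exact: h.
have pw0 s : 0 <= path_weight mu K s.
  by case: s => //= y s; rewrite mulr_ge0 ?m0// chain_weight_ge0.
split=> [s _|]; first exact: pw0.
case: k => [|k].
  rewrite (_ : [set s | _] = [set [::]]); last by apply/seteqP; split => s /= => [/size0nil|->].
  by rewrite esum_set1.
rewrite esum_seqS// -m1; apply: eq_esum => z _ /=.
rewrite ge0_esumZ ?m0//; last by move=> s _; exact: chain_weight_ge0.
by have [_ ->] := chain_weight_pmf k z KP; rewrite mule1.
Qed.

Definition seq_of_fun k (y : 'I_k -> X) : seq X := [seq y i | i <- enum 'I_k].

Lemma size_seq_of_fun k (y : 'I_k -> X) : size (seq_of_fun y) = k.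
Proof. by rewrite size_map size_enum_ord. Qed.

Lemma nth_seq_of_fun k (y : 'I_k -> X) x0 (i : 'I_k) : nth x0 (seq_of_fun y) i = y i.
Proof. by rewrite (nth_map i) ?size_enum_ord// nth_ord_enum. Qed.

Lemma seq_of_fun_inj k (y y' : 'I_k -> X) : seq_of_fun y = seq_of_fun y' -> y =1 y'.
Proof. by move=> yy i; rewrite -(nth_seq_of_fun y (y i)) yy nth_seq_of_fun. Qed.

Lemma mc_weightE k (y : 'I_k -> X) K mu : mc_weight mu K y = path_weight mu K (seq_of_fun y).
Proof.
case: k y => [|k] y; first by rewrite /seq_of_fun (size0nil (size_enum_ord 0)).
have chain_nth x s : chain_weight K x s =
    \prod_(j < size s) K (nth x (x :: s) j) (nth x (x :: s) j.+1).
  elim: s x => [|z s IH] x /=; first by rewrite big_ord0.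
  rewrite big_ord_recl /= IH; congr (_ * _); apply: eq_bigr => j _ /=.
  by congr (K _ _); apply: set_nth_default => //=; rewrite ltnS ltnW.
have e : seq_of_fun y = y ord0 :: behead (seq_of_fun y).
  by rewrite /seq_of_fun enum_ordSl.
rewrite e /= chain_nth -e size_behead size_seq_of_fun /=; congr (_ * _).
apply: eq_bigr => j _.
have h (i : nat) : (i < k.+1)%N -> nth (y ord0) (seq_of_fun y) i = y (inord i).
  by move=> ik; rewrite -(nth_seq_of_fun y (y ord0) (inord i)) inordK.
have jk := ltn_ord j; rewrite (h j (ltnW jk)) (h j.+1 jk) //.
Qed.

Lemma mc_weight_pmf K mu k : stochastic K -> pmf_on [set: X] mu ->
  pmf_on [set: {ffun 'I_k -> X}] (fun y => mc_weight mu K y).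
Proof.
move=> KP mP; have [p0 p1] := path_weight_pmf k KP mP.
split=> [y _|]; first by rewrite mc_weightE p0 //= size_seq_of_fun.
rewrite -p1 (@reindex_esum _ _ _ [set: {ffun 'I_k -> X}] _ (fun y => seq_of_fun y)).
  by apply: eq_esum => y _; rewrite mc_weightE.
split.
- by move=> y _ /=; rewrite size_seq_of_fun.
- by move=> y y' _ _ /seq_of_fun_inj h; apply/ffunP.
- move=> s /= ss; rewrite -ss; exists [ffun i => tnth (in_tuple s) i] => //.
  rewrite /seq_of_fun -[RHS](map_tnth_enum (in_tuple s)).
  by apply: eq_map => i; rewrite ffunE.
Qed.

Lemma Yseq_seq_of_fun k (t : X * seq X) : Yseq k t = seq_of_fun (Yvec k t).
Proof. by rewrite /Yseq /mkseq /seq_of_fun /Yvec -val_enum_ord -map_comp. Qed.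

Lemma Pvec_stick k (t : X * seq X) : Pvec k t = row_of_seq k (stick 1 (Wseq R k t)).
Proof.
apply/rowP => i; rewrite !mxE -Pc_stick (nth_map 0%N) ?size_iota// nth_iota//.
Qed.

End path_weights.

(** * Convergence of clump functionals *)

Section clump_limits.
Variables (R : realType) (X : countType) (G : X -> X -> R).
Variables (theta : R) (M : nat) (pi mu : X -> R).
Hypothesis GP : generator G.
Hypothesis G0 : forall i, G i i != 0.
Hypothesis th0 : 0 < theta.
Hypothesis rth : rate_bound G < theta.
Hypothesis rM : rate_bound G < M%:R.
Hypothesis piP : pmf_on [set: X] pi.
Hypothesis muP : pmf_on [set: X] mu.
Hypothesis muQ : forall j, vecmul mu (Qmat G theta) j = mu j.
Hypothesis pimu : forall j, (fun n => vecpow pi (Qmat G theta) n j) @ \oo --> mu j.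

Let D n := @paths_of_len X n.
Let w := inh_weight pi (Kn G M).
Let G' := Grev G mu.
Let pw := path_weight mu (KG G').
Let wP n : (0 < n)%N -> pmf_on (D n) w.
Proof. by apply: inh_pmf => // v _; exact: Kn_stochastic. Qed.
Let thP : rate_ok G theta. Proof. exact: rate_bound_ok. Qed.
Let G'P : generator G'. Proof. exact: (Grev_generator GP thP). Qed.
Let gpos y : 0 < - G y y. Proof. by rewrite oppr_gt0 generator_diag_lt0. Qed.

(** Rates of [G], not of [G']: they are positive at every state, and agree with those of [G'] along
    paths of positive weight. *)
Definition diag_rates (ys : seq X) : seq R := [seq - G y y | y <- ys].

Lemma mspan_bounded (ths : seq R) H v : mspan ths H v ->
  exists B, forall s, unit_seq s -> `|H s| <= B.
Proof.
elim=> [|c ms {}H {}v _ _ [B HB]]; first by exists 0 => s _; rewrite normr0.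
exists (`|c| + B) => s us; rewrite (le_trans (ler_normD _ _))// lerD ?HB//.
by have /andP[m0 m1] := mono_itv ms us; rewrite normrM ler_piMr// ger0_norm.
Qed.

Lemma clump_bdd (ys : seq X) (H : seq R -> R) (B : R) (E : set (X * seq X)) :
  (forall s, unit_seq s -> size s = size ys -> `|H s| <= B) ->
  bdd_on E (fun t => (Yseq (size ys) t == ys)%:R * H (Wseq R (size ys) t)).
Proof.
move=> HB; apply: bdd_onM; first exact: bdd_on_indicator.
by exists B => t _; apply: HB; [exact: Wseq_unit | rewrite size_mkseq].
Qed.

Lemma clump_cvg_span ys (H : seq R -> R) v : mspan (diag_rates ys) H v ->
  (fun n => wmean (D n) w (fun t => (Yseq (size ys) t == ys)%:R * H (Wseq R (size ys) t)))
    @ \oo --> pw ys * v.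
Proof.
elim=> [|c ms {}H {}v sz sH IH].
  rewrite mulr0; apply: (cvg_trans _ (@cvg_cst R 0 nat \oo _)); apply: near_eq_cvg.
  near=> n; have n0 : (0 < n)%N by near: n; exists 1%N.
  transitivity (wmean (D n) w (fun=> 0)); first by rewrite (wmean_cst (wP n0)).
  by apply: eq_wmean => t _; rewrite mulr0.
have [B HB] := mspan_bounded sH.
have szy : size ms = size ys by rewrite sz size_map.
have cm := moment_cvg GP G0 th0 rth rM piP muP muQ pimu szy.
have : (fun n => c * wmean (D n) w (clump_stat R ys ms) +
   wmean (D n) w (fun t => (Yseq (size ys) t == ys)%:R * H (Wseq R (size ys) t)))
     @ \oo --> pw ys * (c * moment_factor (diag_rates ys) ms + v).
  rewrite mulrDr mulrCA; apply: cvgD => //; apply: cvgM => //; exact: cvg_cst.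
apply: cvg_trans; apply: near_eq_cvg; near=> n.
have n0 : (0 < n)%N by near: n; exists 1%N.
have cb := clump_stat_bdd R (D n) ys ms.
have hb := clump_bdd (D n) (fun s us (_ : size s = size ys) => HB s us).
rewrite -(wmeanZ (wP n0) _ cb) -(wmeanD (wP n0) (bdd_onZ _ cb) hb).
by apply: eq_wmean => t _; rewrite /clump_stat; ring.
Unshelve. all: by end_near. Qed.

Lemma pw_ge0 ys : 0 <= pw ys. Proof. exact: (path_weight_ge0 GP thP muP muQ). Qed.

Lemma clump_cvg ys (H : seq R -> R) B :
  (forall s, unit_seq s -> size s = size ys -> `|H s| <= B) ->
  approximable (diag_rates ys) H ->
  (fun n => wmean (D n) w (fun t => (Yseq (size ys) t == ys)%:R * H (Wseq R (size ys) t)))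
    @ \oo --> pw ys * iter_beta (diag_rates ys) H.
Proof.
move=> HB aH; apply/cvgrPdist_le => e e0.
have p0 := pw_ge0 ys; have P0 : 0 < pw ys + 2 by lra.
(* The errors are [pw ys * d] for replacing [H] by [H'] in the limit, [d] for the convergence with
   [H'], and [d] for the replacement at time [n]. *)
pose d := e / (pw ys + 2); have d0 : 0 < d by rewrite divr_gt0.
have ths0 : all (fun th => 0 < th) (diag_rates ys) by apply/allP => x /mapP[y _ ->].
have [H' [v sH'] HH'] := aH d d0.
have hi := iter_beta_dist ths0 aH sH' HH'.
have [B' HB'] := mspan_bounded sH'.
have /cvgrPdist_le/(_ _ d0) c' := clump_cvg_span sH'.
near=> n.
have n0 : (0 < n)%N by near: n; exists 1%N.
have hb := clump_bdd (D n) HB.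
have hb' := clump_bdd (D n) (fun s us (_ : size s = size ys) => HB' s us).
have := wmeanB (wP n0) hb hb'.
have : `|wmean (D n) w (fun t => (Yseq (size ys) t == ys)%:R * H (Wseq R (size ys) t) -
    (Yseq (size ys) t == ys)%:R * H' (Wseq R (size ys) t))| <= d.
  rewrite -[leRHS](wmean_cst (wP n0)); apply: (ler_norm_wmean (wP n0)); first exact: bdd_on_cst.
  move=> t _; rewrite -mulrBr normrM; have h := HH' _ (Wseq_unit R (size ys) t).
  case: eqP => _; rewrite ?normr0 ?normr1 ?mul0r ?mul1r; last exact: ltW.
  by apply: h; rewrite size_mkseq size_map.
have : `|pw ys * v - wmean (D n) w (fun t => (Yseq (size ys) t == ys)%:R * H' (Wseq R (size ys) t))| <= d.
  by near: n.
have : `|pw ys * iter_beta (diag_rates ys) H - pw ys * v| <= pw ys * d.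
  by rewrite -mulrBr normrM ger0_norm// ler_wpM2l.
set a := pw ys * iter_beta _ _; set b := pw ys * v.
set a' := wmean _ _ (fun t => _ * H _); set b' := wmean _ _ (fun t => _ * H' _).
move=> h1 h2 h3 h4; rewrite {}h4 in h3.
have := ler_normD (a - b) (b - a'); rewrite subrKA.
have := ler_normD (b - b') (b' - a'); rewrite subrKA (distrC b' a').
have dE : (pw ys + 2) * d = e by rewrite /d mulrC divfK// gt_eqF.
lra.
Unshelve. all: by end_near. Qed.

(** By [path_weight_cons2] a tail of weight 0 forces the whole path to have weight 0, and each state
    of the path heads a tail that carries its mass as a factor. *)
Lemma path_weight_support ys y : pw ys != 0 -> y \in ys -> mu y != 0.
Proof.
elim: ys y => [//|x [|z ys] IH] y.
  by rewrite /pw /= mulr1 => mx; rewrite inE => /eqP ->.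
move=> pxz; rewrite inE => /predU1P[->|yz].
  by apply: contraNneq pxz => mx; rewrite /pw /= mx mul0r.
apply: (IH y _ yz); apply: contraNneq pxz => pz.
have := path_weight_cons2 GP G0 thP muP muQ x z ys.
rewrite -/G' -/(pw (z :: ys)) pz mulr0 => /eqP; rewrite mulf_eq0 => /orP[//|].
by rewrite oppr_eq0 (negbTE (G0 x)).
Qed.

Lemma gem_params_support k (y : 'I_k -> X) : mc_weight mu (KG G') y != 0 ->
  [seq gem_params G' y i | i <- enum 'I_k] = diag_rates (seq_of_fun y).
Proof.
rewrite mc_weightE => py; rewrite /diag_rates /seq_of_fun -map_comp.
apply: eq_map => i /=; rewrite /gem_params /G' Grev_diag//.
by apply: (path_weight_support py); apply/mapP; exists i => //; rewrite mem_enum.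
Qed.

Lemma pair_cvg k (f : 'rV[R]_k -> ('I_k -> X) -> R) : bcont2 f ->
  (fun n => wmean (D n) w (fun t => f (Pvec k t) (Yvec k t))) @ \oo --> mccgem_exp G' mu f.
Proof.
move=> [fc [B0 fB0]].
have [B Bge fB] : exists2 B : R, 0 <= B & forall p y, unit_cube p -> `|f p y| <= B.
  exists `|B0| => // p y cp; exact: le_trans (fB0 p y cp) (ler_norm _).
pose Y (t : X * seq X) : {ffun 'I_k -> X} := [ffun i => Yvec k t i].
pose q (y : {ffun 'I_k -> X}) := mc_weight mu (KG G') y.
(* On sequences of weight 0 the GEM parameters may vanish and the Beta estimates do not apply. The
   value 0 is substituted there, which leaves the weighted sum unchanged and keeps [g] bounded by
   [B]. *)
pose g (y : {ffun 'I_k -> X}) := if q y == 0 then 0 else gem_exp (gem_params G' y) (fun p => f p y).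
have -> : mccgem_exp G' mu f = wmean [set: {ffun 'I_k -> X}] q g.
  rewrite /mccgem_exp /wmean; apply: eq_dsum => y _; rewrite /g -/(q y).
  by case: eqVneq => [->|//]; rewrite !mul0r.
have YE (y : {ffun 'I_k -> X}) t : (Y t == y) = (Yseq k t == seq_of_fun y).
  rewrite Yseq_seq_of_fun; apply/eqP/eqP => [<-|/seq_of_fun_inj h].
    by rewrite /seq_of_fun; apply: eq_map => i; rewrite ffunE.
  by apply/ffunP => i; rewrite ffunE h.
have u1 : 0 <= (1 : R) <= 1 by rewrite ler01 lexx.
have cube s : unit_seq s -> unit_cube (row_of_seq k (stick (1 : R) s)).
  by move=> us; apply/row_of_seq_cube/stick_unit.
have bc (y : {ffun 'I_k -> X}) : bcont (fun p => f p y).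
  by split; [exact: fc | exists B => p cp; exact: fB].
pose H (y : {ffun 'I_k -> X}) s := f (row_of_seq k (stick 1 s)) y.
have HB (y : {ffun 'I_k -> X}) s : unit_seq s -> size s = size (seq_of_fun y) -> `|H y s| <= B.
  by move=> us _; exact/fB/cube.
have szd (y : {ffun 'I_k -> X}) : size (diag_rates (seq_of_fun y)) = k.
  by rewrite size_map size_seq_of_fun.
have aH (y : {ffun 'I_k -> X}) : approximable (diag_rates (seq_of_fun y)) (H y).
  exact: (stick_approximable (szd y) (bc y)).
have gE (y : {ffun 'I_k -> X}) : q y * g y = pw (seq_of_fun y) * iter_beta (diag_rates (seq_of_fun y)) (H y).
  rewrite /g /q mc_weightE -/pw; have [->|py] := eqVneq (pw (seq_of_fun y)) 0; first by rewrite !mul0r.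
  by rewrite gem_exp_iter gem_params_support// mc_weightE.
have ths0 (ys : seq X) : all (fun th => 0 < th) (diag_rates ys) by apply/allP => x /mapP[y _ ->].
apply: (wmean_cvg_discrete (Y := Y) Bge wP).
- exact: mc_weight_pmf (KG_stochastic G'P) muP.
- by move=> t; apply: fB; rewrite Pvec_stick; exact/cube/Wseq_unit.
- move=> y; rewrite /g; case: eqVneq => [_|qy]; first by rewrite normr0.
  rewrite gem_exp_iter gem_params_support//.
  (* The bound by [B] is the distance estimate to the zero combination. *)
  rewrite -[X in `|X|]subr0; apply: (iter_beta_dist (ths0 _) (aH y) (mspan0 _)) => s us ss.
  by rewrite subr0; apply: HB => //; rewrite ss szd size_seq_of_fun.
- move=> y; rewrite gE.
  have := clump_cvg (HB y) (aH y); apply: cvg_trans; apply: near_eq_cvg; apply: nearW => n.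
  apply: eq_wmean => t _; rewrite size_seq_of_fun -YE.
  case: eqVneq => [<-|_]; last by rewrite !mul0r.
  rewrite !mul1r /H -Pvec_stick; congr f; apply/funext => i; by rewrite ffunE.
- move=> y.
  (* With all exponents 0 the moment limit is the convergence of the probability that the last [k]
     clumps spell [y]. *)
  have szn : size (nseq k 0%N) = size (seq_of_fun y) by rewrite size_nseq size_seq_of_fun.
  have := moment_cvg GP G0 th0 rth rM piP muP muQ pimu szn.
  have -> : moment_factor [seq - G z z | z <- seq_of_fun y] (nseq k 0%N) = 1.
    have : size (diag_rates (seq_of_fun y)) = k by [].
    rewrite -/(diag_rates _); move: (ths0 (seq_of_fun y)); move: (diag_rates _) => ths + sk.
    rewrite -{k f fc fB0 fB Y q g YE cube bc H HB szd aH gE y szn} sk.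
    elim: ths => [|th ths IH] /=; first by rewrite /moment_factor big_nil.
    by move=> /andP[t0 ts]; rewrite moment_factor_cons IH// addr0 divff ?mulr1// gt_eqF.
  rewrite mulr1 /q mc_weightE; apply: cvg_trans; apply: near_eq_cvg; apply: nearW => n.
  apply: eq_wmean => t _; rewrite /clump_stat size_seq_of_fun -YE.
  suff -> : mono (nseq k 0%N) (Wseq R k t) = 1 by rewrite mulr1.
  by elim: {1}k (Wseq R k t) => //= j IH s; rewrite expr0 IH mul1r.
Qed.

Lemma marginal_cvg k (f : ('I_k -> X) -> R) : bounded_fun f ->
  (fun n => wmean (D n) w (fun t => f (Yvec k t))) @ \oo --> mc_exp mu (KG G') f.
Proof.
move=> [B [_ fB]].
have b2 : bcont2 (fun _ : 'rV[R]_k => f).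
  split; first by move=> y; exact: cst_continuous.
  by exists (B + 1) => p y _; apply: (fB (B + 1)) => //; rewrite ltrDl.
have := pair_cvg b2; congr (_ --> _).
by rewrite /mccgem_exp /mc_exp; apply: eq_dsum => y _; rewrite gem_exp_cst.
Qed.

(** The indicator of a fixed [y] is continuous since the state space is discrete, so this is a case
    of [pair_cvg] whose limiting sum has one term. *)
Lemma restricted_cvg (y : nat -> X) k (g : 'rV[R]_k -> R) : bcont g ->
  (fun n => wmean (D n) w (fun t => g (Pvec k t) * Yeq R k y t)) @ \oo -->
    mc_weight mu (KG G') (fun i : 'I_k => y i) *
    gem_exp (gem_params G' (fun i : 'I_k => y i)) g.
Proof.
move=> [gc [B gB]].
pose f (p : 'rV[R]_k) (z : 'I_k -> X) := g p * [forall i : 'I_k, z i == y i]%:R.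
have b2 : bcont2 f.
  split.
    move=> z; rewrite /f; case: [forall i, _].
      by rewrite (_ : (fun p => _) = g)//; apply/funext => p; rewrite mulr1.
    rewrite (_ : (fun p => _) = (fun=> 0)); first exact: cst_continuous.
    by apply/funext => p; rewrite mulr0.
  exists B => p z cp; rewrite /f; case: [forall i, _]; rewrite ?mulr1 ?mulr0 ?gB//.
  by rewrite normr0; apply: le_trans (gB p cp).
have := pair_cvg b2; congr (_ --> _).
pose yk : {ffun 'I_k -> X} := [ffun i : 'I_k => y i].
have ykE : (yk : 'I_k -> X) = (fun i : 'I_k => y i) by apply/funext => i; rewrite ffunE.
rewrite /mccgem_exp (@dsum_delta _ _ _ yk)// ?ykE.
  congr (_ * gem_exp _ _); apply/funext => p; rewrite /f.
  by rewrite (_ : [forall i, _]) ?mulr1//; apply/forallP => i.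
move=> z _ zy; rewrite (_ : (fun p => f p z) = fun=> 0); first by rewrite gem_exp_cst mulr0.
apply/funext => p; rewrite /f; case: forallP => [h|_]; last by rewrite mulr0.
by move: zy; rewrite (_ : z = yk) ?eqxx//; apply/ffunP => i; rewrite ffunE; exact/eqP.
Qed.

Lemma conditional_cvg (y : nat -> X) k (g : 'rV[R]_k -> R) :
  possible_seq mu (KG G') y -> bcont g ->
  (fun n => wmean (D n) w (fun t => g (Pvec k t) * Yeq R k y t) / wmean (D n) w (Yeq R k y)) @ \oo -->
    gem_exp (gem_params G' (fun i : 'I_k => y i)) g.
Proof.
move=> yP bg; have cn := restricted_cvg (y := y) bg.
have b1 : bcont (fun _ : 'rV[R]_k => 1 : R).
  by split; [exact: cst_continuous | exists 1 => p _; rewrite normr1].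
have cd := restricted_cvg (y := y) b1; rewrite gem_exp_cst mulr1 in cd.
(* This is where possibility of [y] enters: the limit of the denominators is positive. *)
have q0 : mc_weight mu (KG G') (fun i : 'I_k => y i) != 0.
  case: k {g bg cn b1 cd} => [|k] /=; first exact: oner_neq0.
  have := yP k; rewrite lt0r => /andP[+ _]; congr (_ * _ != 0).
  apply: eq_bigr => j _; have jk := ltn_ord j.
  by rewrite (@inordK k j (ltnW jk)) (@inordK k j.+1 jk).
set q := mc_weight _ _ _ in q0 cn cd; set ge := gem_exp _ _ in cn *.
rewrite (_ : ge = q * ge / q); last by rewrite mulrAC divff// mul1r.
have e : (fun n => wmean (D n) w (fun t => 1 * Yeq R k y t)) =
    (fun n => wmean (D n) w (Yeq R k y)).
  by apply/funext => n; apply: eq_wmean => t _; rewrite mul1r.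
rewrite e in cd; apply: cvgM => //; exact: cvgV.
Qed.

End clump_limits.

Theorem mainTheorem3 (R : realType) (X : countType) (G : X -> X -> R)
  (theta : R) (M : nat) (pi mu : X -> R) :
  generator G ->
  (forall i, G i i != 0) ->
  0 < theta ->
  rate_bound G < theta ->
  rate_bound G < M%:R ->
  prob_vec pi ->
  prob_vec mu ->
  (forall j, vecmul mu (Qmat G theta) j = mu j) ->
  (forall j, (fun n => vecpow pi (Qmat G theta) n j) @ \oo --> mu j) ->
  [/\ generator (Grev G mu),
      (* Y_n  ==>  Y' (finite-dimensional distributions) *)
      (forall (k : nat) (f : ('I_k -> X) -> R), bounded_fun f ->
         (fun n => inh_exp pi (Kn G M) n.+1 (fun t => f (Yvec k t)))
           @ \oo --> mc_exp mu (KG (Grev G mu)) f),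
      (* P_n | Y_n = y  ==>  disordered GEM with parameters -G'_{y_j,y_j} *)
      (forall y : nat -> X, possible_seq mu (KG (Grev G mu)) y ->
       forall (k : nat) (g : 'rV[R]_k -> R), bcont g ->
         (fun n => inh_exp pi (Kn G M) n.+1
                     (fun t => g (Pvec (R:=R) k t) * Yeq R k y t)
                   / inh_exp pi (Kn G M) n.+1 (Yeq R k y))
           @ \oo --> gem_exp (gem_params (Grev G mu) (fun i : 'I_k => y i)) g) &
      (* (P_n, Y_n)  ==>  MCcGEM(G') w.r.t. mu (finite-dimensional distributions) *)
      (forall (k : nat) (f : 'rV[R]_k -> ('I_k -> X) -> R), bcont2 f ->
         (fun n => inh_exp pi (Kn G M) n.+1 (fun t => f (Pvec (R:=R) k t) (Yvec k t)))
           @ \oo --> mccgem_exp (Grev G mu) mu f)].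
Proof.
move=> GP G0 th0 rth rM [pi0 pi1] [mu0 mu1] muQ pimu.
have piP : pmf_on [set: X] pi by split.
have muP : pmf_on [set: X] mu by split.
split.
- exact: Grev_generator GP (rate_bound_ok GP rth) muP muQ.
(* Paths have length at least 1, so the statement starts at [n.+1]; the shift does not change the
   limits. *)
- move=> k f bf; have := marginal_cvg GP G0 th0 rth rM piP muP muQ pimu bf.
  by rewrite -cvg_shiftS.
- move=> y yP k g bg; have := conditional_cvg GP G0 th0 rth rM piP muP muQ pimu yP bg.
  by rewrite -cvg_shiftS.
- move=> k f bf; have := pair_cvg GP G0 th0 rth rM piP muP muQ pimu bf.
  by rewrite -cvg_shiftS.
Qed.
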